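(* Let $\mu,\nu$ be Borel probability measures on $\mathbb{R}^d$, and let $\sigma^2:=\sigma^2(\mu\star\nu)$ denote the largest variance of the convolution $\mu\star\nu$ in any direction. Then $$C_p(\mu\star\nu)\le \big(C_p(\mu)+C_p(\nu)\big)-\frac{C_p(\mu)\,C_p(\nu)}{C_p(\mu)+C_p(\nu)}\cdot\frac{\big(C_p(\mu\star\nu)-\sigma^2\big)^2}{\big(C_p(\mu\star\nu)-\sigma^2\big)^2+C_p(\mu\star\nu)\,\sigma^2}.$$
   Context: A Borel probability measure $\mu$ on $\mathbb{R}^d$ satisfies a Poincaré inequality with constant $C\ge 0$ if $\operatorname{Var}_\mu(f)\le C\int_{\mathbb{R}^d}|\nabla f|^2\,d\mu$ for all locally Lipschitz functions $f:\mathbb{R}^d\to\mathbb{R}$, where $\nabla$ is the usual gradient and $|\cdot|$ the Euclidean norm (at points $x$ where $f$ is not differentiable, $|\nabla f|(x):=\limsup_{y\to x}|f(x)-f(y)|/|x-y|$). The Poincaré constant $C_p(\mu)\in[0,\infty]$ is the smallest constant $C$ for which this holds, with $C_p(\mu)=\infty$ if there is none. For a probability measure $\mu$ on $\mathbb{R}^d$, $\sigma^2(\mu):=\max_{\alpha\in\mathbb{R}^d:|\alpha|=1}\operatorname{Var}_\mu(x\mapsto\alpha\cdot x)$, the largest eigenvalue of the covariance matrix of $\mu$. If $C_p(\mu)+C_p(\nu)=\infty$ the right-hand side is understood as $+\infty$ (the inequality is then trivial); a quotient $0/0$ is understood as $0$. *)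

(* Defs.v *)
From HB Require Import structures.
From mathcomp Require Import all_boot all_order all_algebra.
From mathcomp Require Import all_classical all_reals all_analysis.
From mathcomp Require Import measurable_realfun.
Set Implicit Arguments.
Unset Strict Implicit.
Unset Printing Implicit Defensive.
Import Order.TTheory GRing.Theory Num.Theory.
Import numFieldNormedType.Exports.
Local Open Scope classical_set_scope.
Local Open Scope ring_scope.

(* R^d with its Borel sigma-algebra. The topology of 'rV[R]_d is that of the
   sup norm, hence the Euclidean one. *)
Notation borelRn R d := (g_sigma_algebraType (@open 'rV[R]_d)).

Section euclidean.
Context {R : realType} {d : nat}.
Implicit Types (x y : 'rV[R]_d) (f : 'rV[R]_d -> R).

Definition dotv x y : R := \sum_(i < d) x 0 i * y 0 i.

(* The norm `|x| of the library on 'rV[R]_d is the sup norm. *)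
Definition enorm x : R := Num.sqrt (dotv x x).

(* The Lipschitz constants are taken for the sup norm; since all norms on R^d
   are equivalent, the class of functions is the Euclidean one. *)
Definition locally_lipschitz f : Prop :=
  forall x, exists2 U : set 'rV[R]_d, nbhs x U & [lipschitz f z | z in U].

Definition gradient f x : 'rV[R]_d := \row_(i < d) 'D_(delta_mx 0 i) f x.

Definition gradient_norm f x : \bar R :=
  if `[< differentiable f x >] then (enorm (gradient f x))%:E
  else limf_esup (fun y => (`|f x - f y| / enorm (x - y))%:E) x^'.

End euclidean.

Section measurability.
Context {R : realType} {d : nat}.

Lemma continuous_borel_measurable (f : 'rV[R]_d -> R) :
  continuous f -> measurable_fun [set: borelRn R d] f.
Proof.
move=> /continuousP cf.
apply: (measurability _ (RGenOpens.measurableE R)).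
move=> _ [_ [a [b ->] <-]]; rewrite setTI.
apply: sub_sigma_algebra; apply: cf; exact: interval_open.
Qed.

(* The Borel sigma-algebra of R^d is generated by the coordinates. *)
Lemma measurable_fun_rV dT (T : measurableType dT) (f : T -> borelRn R d) :
  (forall i, measurable_fun [set: T] (fun t => (f t : 'rV[R]_d) 0 i)) ->
  measurable_fun [set: T] f.
Proof.
move=> mf.
apply: (@measurability _ _ T (borelRn R d) setT f (@open 'rV[R]_d) erefl).
move=> _ [U oU <-]; rewrite setTI.
pose box (q : 'rV[rat]_d * 'rV[rat]_d) := [set x : 'rV[R]_d |
  forall i, x 0 i \in `]ratr (q.1 0 i), ratr (q.2 0 i)[].
pose F q := f @^-1` (if `[< box q `<=` U >] then box q else set0).
have -> : f @^-1` U = \bigcup_q F q.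
  apply/seteqP; split => [t /= Ut|t [q _]]; last first.
    by rewrite /F /=; case: asboolP => // qU /qU.
  have [e /= e0 eU] : nbhs_ball (f t) U by apply/nbhs_ballP/open_nbhs_nbhs.
  have /choice[a Ha] : forall i : 'I_d, exists q : rat,
      ratr q \in `]((f t : 'rV[R]_d) 0 i - e), ((f t : 'rV[R]_d) 0 i)[.
    by move=> i; apply: rat_in_itvoo; rewrite ltrBlDr ltrDl.
  have /choice[b Hb] : forall i : 'I_d, exists q : rat,
      ratr q \in `]((f t : 'rV[R]_d) 0 i), ((f t : 'rV[R]_d) 0 i + e)[.
    by move=> i; apply: rat_in_itvoo; rewrite ltrDl.
  exists (\row_i a i, \row_i b i) => //; rewrite /F /=.
  case: asboolP => [_|]; first by move=> i; rewrite !mxE in_itv /=;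
    move: (Ha i) (Hb i); rewrite !in_itv /= => /andP[_ ->] /andP[->].
  case => y /= yb; apply: eU; split=> // j i; rewrite (ord1 j) /ball /=.
  move: (yb i) (Ha i) (Hb i); rewrite !mxE !in_itv /=.
  move=> /andP[y1 y2] /andP[a1 _] /andP[_ b2].
  rewrite ltr_distlC (lt_trans a1 y1) /=; exact: lt_trans b2.
apply: (@countable_bigcupT_measurable _ _ _ F) => [|q].
  exact: countableP.
rewrite /F; case: asboolP => _; last by rewrite preimage_set0.
rewrite (_ : f @^-1` box q = \big[setI/setT]_(i < d)
    ((fun t => (f t : 'rV[R]_d) 0 i) @^-1` `]ratr (q.1 0 i), ratr (q.2 0 i)[)).
  apply: bigsetI_measurable => i _; rewrite -[X in measurable X]setTI.
  by apply: mf => //; exact: measurable_itv.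
rewrite -bigcap_seq; apply/seteqP; split => t /=.
  by move=> bt i _; exact: bt.
by move=> bt i; apply: bt; rewrite /= mem_index_enum.
Qed.

End measurability.

Section convolution.
Context {R : realType} {d : nat}.

Definition addRn (z : borelRn R d * borelRn R d) : borelRn R d :=
  (z.1 : 'rV[R]_d) + (z.2 : 'rV[R]_d).

Lemma measurable_addRn : measurable_fun setT addRn.
Proof.
apply: measurable_fun_rV => i.
have mc : measurable_fun [set: borelRn R d] (fun x : 'rV[R]_d => x 0 i).
  by apply: continuous_borel_measurable; exact: coord_continuous.
under eq_fun do rewrite mxE.
by apply: measurable_funD; apply: (measurableT_comp mc);
  [exact: measurable_fst|exact: measurable_snd].
Qed.

HB.instance Definition _ := isMeasurableFun.Build _ _ _ _ addRn measurable_addRn.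

(* mu * nu is the law of x + y under the product measure. *)
Definition convolution (mu nu : probability (borelRn R d) R) :
    probability (borelRn R d) R :=
  distribution (mu \x nu)%E addRn.

End convolution.

Section poincare.
Local Open Scope ereal_scope.
Context {R : realType} {d : nat}.
Implicit Type mu : probability (borelRn R d) R.

(* 'V_mu[f] is +oo when f is not square-integrable. *)
Definition poincare_inequality mu (C : R) : Prop :=
  forall f : 'rV[R]_d -> R, locally_lipschitz f ->
    'V_mu[f] <= C%:E * \int[mu]_x (gradient_norm f x) ^+ 2.

(* The infimum of the empty set is +oo; a finite infimum is attained, so this is
   the smallest admissible constant. *)
Definition poincare_constant mu : \bar R :=
  ereal_inf [set C%:E | C in [set C : R | (0 <= C)%R /\ poincare_inequality mu C]].

(* The supremum is attained as soon as 0 < d; it is +oo when some linear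
   functional is not square-integrable. *)
Definition max_variance mu : \bar R :=
  ereal_sup [set 'V_mu[dotv alpha] | alpha in [set alpha | enorm alpha = 1%R]].

End poincare.

(* In \bar R, 0^-1 = +oo, +oo^-1 = 0 and 0 * +oo = 0. Hence 0 / 0 = 0, and
   a + b - a * b / (a + b) * r is +oo whenever a + b = +oo. *)
Section conventions.
Local Open Scope ereal_scope.
Context {R : realType}.

Lemma divee00 : 0 / 0 = 0 :> \bar R.
Proof. by rewrite mul0e. Qed.

Lemma poincare_bound_y (a b r : \bar R) : a + b = +oo ->
  a + b - a * b / (a + b) * r = +oo.
Proof. by move=> ->; rewrite invey mule0 mul0e sube0. Qed.

End conventions.

(* Main.v *)
Require Import Defs.
From mathcomp Require Import all_boot all_order all_algebra.
From mathcomp Require Import all_classical all_reals all_analysis.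
From mathcomp Require Import ring lra measurable_realfun.

(** Write m for the law of X + Y, with X of law mu and Y of law nu, and let a, b
    and c be the Poincare constants of mu, nu and m, which may be supposed finite.
    Put k = a * b / (a + b).

    For a smooth bounded f, condition on X: the variance of f (X + Y) is the mean
    of the conditional variance, at most b E |grad f|^2 by the inequality for nu,
    plus the variance of the conditional mean, whose gradient is E [grad f | X],
    hence at most a E |E [grad f | X]|^2 by the inequality for mu
    ([conditional_poincare]). Conditioning on Y instead exchanges the roles of a
    and b. The average of the two bounds with weights b / (a + b) and a / (a + b),
    together with the Efron-Stein inequality for each partial derivative
    ([efron_stein]), gives ([convolution_smooth_poincare])

      Var_m f <= (a + b - k) E |grad f|^2 + k |E grad f|^2.

    It remains to see that the mean gradient of a near-extremal f is small. Let
    v = E grad f and perturb f by multiples of the linear function x |-> v . x.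
    Since f nearly attains c, Cov (f, v . x) is nearly c |v|^2, whereas the
    Cauchy-Schwarz inequality bounds it by sqrt (c E |grad f|^2) sigma |v|; hence
    |v|^2 is at most about (sigma^2 / c) E |grad f|^2
    ([near_extremal_gradient]). Consequently c <= a + b - k (1 - sigma^2 / c)
    ([convolution_stability]), which implies the stated bound because
    (c - s)^2 / ((c - s)^2 + c s) <= 1 - s / c for 0 <= s <= c, 0 < c.

    The Poincare constant is defined with all locally Lipschitz functions, and the
    gradient norm is the local slope at the points where the function is not
    differentiable. The measures may be singular and may charge such points, so
    the argument above does not apply to these functions directly. One has to
    show that an inequality for smooth functions implies the inequality for all
    locally Lipschitz ones ([poincare_of_smooth]). The slope of f is the decreasing
    limit of the functions x |-> sup over 0 < |y - x| < r of |f y - f x| / |y - x|,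
    which are lower semicontinuous. Given a lower semicontinuous h strictly above
    the slope of f, f is a uniform limit from below of functions whose slope has a
    Lipschitz bound not exceeding h ([relaxation]). This is the comparison
    principle for the eikonal equation |grad u| = h, in the form of Perron's
    method: as long as u is far below f near a point, u can be raised there by a
    cone. A mollification keeps a continuous slope bound up to a small
    error ([smooth_approximation]), and dominated convergence together with Fatou's
    lemma for the variance ([variance_fatou]) concludes. *)

Set Implicit Arguments.
Unset Strict Implicit.
Unset Printing Implicit Defensive.
Import Order.TTheory GRing.Theory Num.Theory.
Import numFieldNormedType.Exports.
Local Open Scope classical_set_scope.
Local Open Scope ring_scope.


(** * Euclidean norm, compactness and local slopes *)

Section max_min_lipschitz.
Context {R : realType}.
Implicit Types a b c : R.

Lemma ler_dist_max a b c : `|Num.max a b - Num.max a c| <= `|b - c|.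
Proof.
have h1 := ler_norm (b - c); have h2 := ler_norm (c - b).
rewrite distrC in h2; rewrite ler_norml.
by case: (leP a b) => ?; case: (leP a c) => ?; apply/andP; split; lra.
Qed.

Lemma ler_dist_min a b c : `|Num.min a b - Num.min a c| <= `|b - c|.
Proof.
have h1 := ler_norm (b - c); have h2 := ler_norm (c - b).
rewrite distrC in h2; rewrite ler_norml.
by case: (leP a b) => ?; case: (leP a c) => ?; apply/andP; split; lra.
Qed.

End max_min_lipschitz.

Section euclidean_norm.
Context {R : realType} {d : nat}.
Implicit Types (x y z v : 'rV[R]_d).

Lemma dotvC x y : dotv x y = dotv y x.
Proof. by apply: eq_bigr => i _; rewrite mulrC. Qed.

Lemma dotvDl x y z : dotv (x + y) z = dotv x z + dotv y z.
Proof. by rewrite -big_split; apply: eq_bigr => i _; rewrite mxE mulrDl. Qed.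

Lemma dotvDr x y z : dotv z (x + y) = dotv z x + dotv z y.
Proof. by rewrite dotvC dotvDl !(dotvC z). Qed.

Lemma dotvZl (a : R) x y : dotv (a *: x) y = a * dotv x y.
Proof. by rewrite /dotv mulr_sumr; apply: eq_bigr => i _; rewrite mxE mulrA. Qed.

Lemma dotvZr (a : R) x y : dotv x (a *: y) = a * dotv x y.
Proof. by rewrite dotvC dotvZl dotvC. Qed.

Lemma dotvNr x y : dotv x (- y) = - dotv x y.
Proof. by rewrite -scaleN1r dotvZr mulN1r. Qed.

Lemma dotvBr x y z : dotv z (x - y) = dotv z x - dotv z y.
Proof. by rewrite dotvDr dotvNr. Qed.

Lemma dotvBl x y z : dotv (x - y) z = dotv x z - dotv y z.
Proof. by rewrite dotvC dotvBr !(dotvC z). Qed.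

Lemma dotv_ge0 x : 0 <= dotv x x.
Proof. by apply: sumr_ge0 => i _; rewrite -expr2 sqr_ge0. Qed.

Lemma enorm_ge0 x : 0 <= enorm x.
Proof. exact: sqrtr_ge0. Qed.
Hint Resolve enorm_ge0 : core.

Lemma enorm_sqr x : enorm x ^+ 2 = dotv x x.
Proof. by rewrite sqr_sqrtr ?dotv_ge0. Qed.

Lemma cauchy_schwarz_dotv x y : `|dotv x y| <= enorm x * enorm y.
Proof.
rewrite -ler_sqr ?nnegrE ?mulr_ge0// real_normK ?num_real// exprMn !enorm_sqr.
have [y0|y0] := eqVneq (dotv y y) 0.
  have yi i : y 0 i = 0.
    apply/eqP; rewrite -sqrf_eq0 expr2; apply/eqP.
    by move/psumr_eq0P : y0; apply => // j _; rewrite -expr2 sqr_ge0.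
  rewrite y0 mulr0 /dotv big1 ?expr0n// => i _; by rewrite yi mulr0.
have yp : 0 < dotv y y by rewrite lt0r y0 dotv_ge0.
have := dotv_ge0 (dotv y y *: x - dotv x y *: y).
rewrite dotvBl !dotvBr !dotvZl !dotvZr (dotvC y x).
rewrite (_ : _ - _ = dotv y y * (dotv x x * dotv y y - dotv x y ^+ 2)); last ring.
by rewrite pmulr_rge0// subr_ge0.
Qed.

Lemma enormZ (a : R) x : enorm (a *: x) = `|a| * enorm x.
Proof.
by rewrite /enorm dotvZl dotvZr mulrA -expr2 sqrtrM ?sqr_ge0// sqrtr_sqr.
Qed.

Lemma enormN x : enorm (- x) = enorm x.
Proof. by rewrite -scaleN1r enormZ normrN1 mul1r. Qed.

Lemma enormB x y : enorm (x - y) = enorm (y - x).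
Proof. by rewrite -enormN opprB. Qed.

Lemma enorm0 : enorm (0 : 'rV[R]_d) = 0.
Proof. by rewrite -(scale0r 0) enormZ normr0 mul0r. Qed.

Lemma ler_enormD x y : enorm (x + y) <= enorm x + enorm y.
Proof.
rewrite -ler_sqr ?nnegrE ?addr_ge0// enorm_sqr dotvDl !dotvDr sqrrD !enorm_sqr.
have := le_trans (ler_norm _) (cauchy_schwarz_dotv x y).
rewrite (dotvC y x); lra.
Qed.

Lemma ler_distD_enorm z x y : enorm (x - y) <= enorm (x - z) + enorm (z - y).
Proof. by rewrite -[x - y](subrKA z) ler_enormD. Qed.

Lemma norm_coord_le_enorm x i : `|x 0 i| <= enorm x.
Proof.
rewrite -ler_sqr ?nnegrE// real_normK ?num_real// enorm_sqr /dotv (bigD1 i)//=.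
by rewrite expr2 lerDl sumr_ge0// => j _; rewrite -expr2 sqr_ge0.
Qed.

Lemma mx_norm_coord x i : `|x 0 i| <= `|x|.
Proof.
rewrite [leRHS]mx_normrE.
by rewrite (le_trans _ (le_bigmax _ _ (0, i))).
Qed.

Lemma mx_norm_le_enorm x : `|x| <= enorm x.
Proof.
rewrite [leLHS]mx_normrE; apply: bigmax_le => // -[j i] _ /=.
by rewrite (ord1 j); exact: norm_coord_le_enorm.
Qed.

Lemma enorm_le_mx_norm x : enorm x <= d%:R * `|x|.
Proof.
rewrite -ler_sqr ?nnegrE ?mulr_ge0// enorm_sqr exprMn.
apply: (@le_trans _ _ (d%:R * `|x| ^+ 2)).
  rewrite /dotv (@le_trans _ _ (\sum_(i < d) `|x| ^+ 2))//.
    apply: ler_sum => i _; rewrite -expr2 -real_normK ?num_real//.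
    by rewrite ler_sqr ?nnegrE// mx_norm_coord.
  by rewrite sumr_const card_ord mulr_natl.
rewrite ler_wpM2r ?sqr_ge0// expr2 -natrM ler_nat.
by case: (d) => // n; rewrite leq_pmulr.
Qed.

Lemma nbhs_enormP x (U : set 'rV[R]_d) :
  nbhs x U <-> exists2 r, 0 < r & forall y, enorm (y - x) < r -> U y.
Proof.
split=> [/nbhs_ballP[r /= r0 rU]|[r r0 rU]].
  exists r => // y yr; apply: rU; rewrite -ball_normE /=.
  by rewrite distrC; exact: le_lt_trans (mx_norm_le_enorm _) yr.
apply/nbhs_ballP; exists (r / d.+1%:R) => /=; first by rewrite divr_gt0.
move=> y; rewrite -ball_normE /= distrC => xy; apply: rU.
rewrite (le_lt_trans (enorm_le_mx_norm _))// mulrC.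
apply: (@le_lt_trans _ _ (`|y - x| * d.+1%:R)).
  by rewrite ler_wpM2l// ler_nat.
by rewrite -ltr_pdivlMr.
Qed.

Lemma compact_enorm_ball r : compact [set y : 'rV[R]_d | enorm y <= r].
Proof.
apply: bounded_closed_compact.
  exists r; split; first by rewrite num_real.
  move=> s rs y /= yr; apply: le_trans (mx_norm_le_enorm y) _.
  exact: le_trans yr (ltW rs).
rewrite -openC openE => y /= /negP; rewrite -ltNge => yr.
apply/nbhs_enormP; exists (enorm y - r); first by rewrite subr_gt0.
move=> z zy; apply/negP; rewrite -ltNge.
have := ler_distD_enorm z y 0; rewrite !subr0 enormB; lra.
Qed.

End euclidean_norm.
#[global] Hint Extern 0 (is_true (0 <= enorm _)) => exact: enorm_ge0 : core.

Section compactness.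
Context {T : topologicalType}.

(** If K were bad, the sets whose complement in K is good would form a proper
    filter containing K but clustering nowhere. This form of compactness lets the
    witnesses of P be transformed, not only selected, when local pieces are
    united. *)
Lemma compact_local_to_global (K : set T) (P : set T -> Prop) : compact K ->
  P set0 -> (forall A B, P A -> P B -> P (A `|` B)) ->
  (forall A B, A `<=` B -> P B -> P A) ->
  (forall x, K x -> exists2 U, nbhs x U & P U) -> P K.
Proof.
move=> cK P0 PU Psub Ploc; apply: contrapT => nPK.
pose F := [set A | P (K `\` A)].
have FF : ProperFilter F.
  split; first by rewrite /F /= setD0.
  split=> [|A B FA FB|A B AB FA]; rewrite /F /=.
  - by rewrite setDT.
  - by rewrite setDIr; exact: PU.
  - by apply: Psub FA => x [Kx Bx]; split => // /AB.
have FK : F K by rewrite /F /= setDv.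
have [x [Kx clx]] := cK F FF FK.
have [U Ux PUU] := Ploc x Kx.
have FU : F (~` U) by apply: Psub PUU => y [_] /= /contrapT.
by have [y [/= nUy Uy]] := clx _ _ FU Ux.
Qed.

End compactness.

Section slope.
Context {R : realType} {d : nat}.
Implicit Types (x y z v : 'rV[R]_d) (f g u : 'rV[R]_d -> R) (c k : R).

(** An upper bound of the limsup of |f y - f x| / |y - x| at x, without a
    quotient and therefore without exception at y = x. *)
Definition slope_le f x c := forall e, 0 < e -> exists2 r, 0 < r &
  forall y, enorm (y - x) < r -> `|f y - f x| <= (c + e) * enorm (y - x).

Definition elip (L : R) f := forall x y, `|f x - f y| <= L * enorm (x - y).

Lemma slope_leW f x c c' : c <= c' -> slope_le f x c -> slope_le f x c'.
Proof.
move=> cc' fc e /fc[r r0 H]; exists r => // y /H/le_trans; apply.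
by rewrite ler_wpM2r// lerD2r.
Qed.

Lemma elip_slope f L : elip L f -> forall x, slope_le f x L.
Proof.
move=> fL x e e0; exists 1 => // y _; apply: le_trans (fL _ _) _.
by rewrite ler_wpM2r// lerDl ltW.
Qed.

Lemma slope_le_near f g x c : (exists2 r, 0 < r & forall y, enorm (y - x) < r ->
  f y = g y) -> slope_le g x c -> slope_le f x c.
Proof.
move=> [r r0 fg] gc e /gc[s s0 H]; exists (Num.min r s).
  by rewrite lt_min r0.
move=> y; rewrite lt_min => /andP[yr ys]; rewrite !fg ?subrr ?enorm0//.
exact: H.
Qed.

Lemma slope_le_max f g x c : slope_le f x c -> slope_le g x c ->
  slope_le (fun y => Num.max (f y) (g y)) x c.
Proof.
move=> fc gc e e0; have [r r0 Hf] := fc _ e0; have [s s0 Hg] := gc _ e0.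
exists (Num.min r s); first by rewrite lt_min r0.
move=> y; rewrite lt_min => /andP[/Hf + /Hg]; rewrite !ler_norml.
move=> /andP[f1 f2] /andP[g1 g2].
by case: (leP (f y) (g y)) => h1; case: (leP (f x) (g x)) => h2; lra.
Qed.

(** A mean value inequality without differentiability. For every e > 0 the
    parameters t at which the increment from x is at most (c + e) t |y - x| have a
    supremum; by the slope bound there, the supremum has this property too, and it
    could be increased if it were less than 1. *)
Lemma slope_le_segment f c x y :
  (forall t : R, 0 <= t <= 1 -> slope_le f (x + t *: (y - x)) c) ->
  `|f y - f x| <= c * enorm (y - x).
Proof.
move=> H; apply/ler_addgt0Pr => e0 e00.
pose N := enorm (y - x).
pose e := e0 / (N + 1).
have N0 : 0 <= N by exact: enorm_ge0.
have e_gt0 : 0 < e by rewrite divr_gt0// ltr_wpDl.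
have eN : e * N <= e0.
  by rewrite /e mulrAC ler_pdivrMr ?ltr_wpDl// mulrDr mulr1 lerDl ltW.
apply: (@le_trans _ _ ((c + e) * N)); last by rewrite mulrDl lerD2l.
pose p (t : R) := x + t *: (y - x).
pose S := [set t : R | 0 <= t <= 1 /\ `|f (p t) - f x| <= (c + e) * N * t].
have pB s t : enorm (p s - p t) = `|s - t| * N.
  by rewrite /p opprD addrACA subrr add0r -scalerBl enormZ.
have S0 : S 0.
  by split; rewrite ?lexx ?ler01// /p scale0r addr0 subrr normr0 mulr0.
have supS : has_sup S by split; [exists 0|exists 1 => t [/andP[]]].
pose t := sup S.
have t01 : 0 <= t <= 1.
  apply/andP; split; first exact: sup_upper_bound S0.
  by apply: ge_sup; [exists 0|move=> s [/andP[]]].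
have [r r0 Hr] := H t t01 e e_gt0.
pose q := r / (N + 1).
have q0 : 0 < q by rewrite divr_gt0// ltr_wpDl.
have near s : `|s - t| < q -> `|f (p s) - f (p t)| <= (c + e) * N * `|s - t|.
  move=> st; rewrite -/(p t) in Hr.
  rewrite -mulrA (mulrC N) -pB; apply: Hr; rewrite pB.
  have : `|s - t| * (N + 1) < r by rewrite -ltr_pdivlMr// ltr_wpDl.
  by apply: le_lt_trans; rewrite ler_wpM2l// lerDl.
have St : S t.
  split => //.
  have [s Ss ts] := sup_adherent q0 supS.
  have st : s <= t by exact: sup_upper_bound.
  have {}ts : `|s - t| < q by rewrite ler0_norm ?subr_le0// opprB ltrBlDr addrC -ltrBlDr.
  have := near s ts; rewrite distrC (ler0_norm (_ : s - t <= 0)) ?subr_le0// => h.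
  rewrite (le_trans (ler_distD (f (p s)) _ _))//.
  move: Ss => [_ h2]; lra.
suff t1 : t = 1.
  by move: St => [_]; rewrite t1 mulr1 /p scale1r subrKC.
apply/eqP; rewrite eq_le (andP t01).2 leNgt; apply/negP => t1.
pose s := Num.min 1 (t + q / 2).
have ts : t < s by rewrite lt_min t1 ltrDl divr_gt0.
have stq : `|s - t| < q.
  have : s <= t + q / 2 by rewrite ge_min lexx orbT.
  by rewrite gtr0_norm ?subr_gt0//; lra.
suff /(sup_upper_bound supS) : S s by rewrite leNgt ts.
split.
  by rewrite ge_min lexx (le_trans (andP t01).1)// ltW.
have := near s stq; rewrite (gtr0_norm (_ : 0 < s - t)) ?subr_gt0// => h.
rewrite (le_trans (ler_distD (f (p t)) _ _))//.
move: St => [_ h2]; lra.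
Qed.

End slope.

(** * Lower approximations with a continuous slope bound *)

Section relaxation.
Context {R : realType} {d : nat}.
Implicit Types (x y z : 'rV[R]_d) (u v k : 'rV[R]_d -> R).
Variables (f h : 'rV[R]_d -> R).

(** The Perron family of f and h. Since h is only lower semicontinuous, it does
    not survive a mollification; a Lipschitz bound k below h does. *)
Definition relaxed u := (forall x, 0 <= u x <= f x) /\
  exists k l, elip l k /\ forall x, 0 <= k x <= h x /\ slope_le u x (k x).

Lemma elip_max l l' u k : elip l u -> elip l' k ->
  elip (Num.max l l') (fun x => Num.max (u x) (k x)).
Proof.
move=> ul kl x y.
have hu : `|u x - u y| <= Num.max l l' * enorm (x - y).
  by apply: le_trans (ul x y) _; rewrite ler_wpM2r// le_max lexx.
have hk : `|k x - k y| <= Num.max l l' * enorm (x - y).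
  by apply: le_trans (kl x y) _; rewrite ler_wpM2r// le_max lexx orbT.
move: hu hk; rewrite !ler_norml => /andP[f1 f2] /andP[g1 g2].
by case: (leP (u x) (k x)) => h1; case: (leP (u y) (k y)) => h2; lra.
Qed.

Lemma relaxed_max u v : relaxed u -> relaxed v ->
  relaxed (fun x => Num.max (u x) (v x)).
Proof.
move=> [uf [k [l [kl uk]]]] [vf [k' [l' [kl' vk]]]]; split.
  move=> x; have /andP[? ?] := uf x; have /andP[? ?] := vf x.
  by rewrite le_max ge_max; apply/andP; split; [apply/orP; left|apply/andP].
exists (fun x => Num.max (k x) (k' x)), (Num.max l l'); split.
  exact: elip_max.
move=> x; have [/andP[k0 kh] us] := uk x; have [/andP[k0' kh'] vs] := vk x.
split.
  by rewrite le_max ge_max; apply/andP; split; [apply/orP; left|apply/andP].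
apply: slope_le_max.
  by apply: slope_leW us; rewrite le_max lexx.
by apply: slope_leW vs; rewrite le_max lexx orbT.
Qed.

Hypothesis h0 : forall x, 0 <= h x.
Hypothesis h_lsc : forall x c, c < h x ->
  exists2 r, 0 < r & forall y, enorm (y - x) < r -> c < h y.
Hypothesis f_slope : forall x, exists2 c, 0 <= c < h x &
  exists2 r, 0 < r & forall y, enorm (y - x) < r ->
    `|f y - f x| <= c * enorm (y - x).

(** Let c' < c < h x0 with c' a bound of the difference quotients of f at x0. If
    f - t <= u, the cone of slope c with apex slightly above f - t at x0 stays below
    f, and it falls below f - t, hence below u, before the distance r, because f
    decreases at most at rate c' < c. So it can be glued to u by a maximum. The
    gain eta depends neither on u nor on t, which lets the bumps be iterated. *)
Lemma relaxed_bump x0 (D : R) : 0 < D -> exists2 U, nbhs x0 U &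
  exists2 eta, 0 < eta & forall t u, D <= t -> relaxed u ->
    (forall y, f y - t <= u y) ->
    exists2 v, relaxed v & (forall y, u y <= v y) /\
      forall y, U y -> f y - t + eta <= v y.
Proof.
move=> D0.
have [c' /andP[c'0 c'h] [r1 r10 fr1]] := f_slope x0.
pose c := (c' + h x0) / 2.
have c'c : c' < c by rewrite /c; lra.
have ch : c < h x0 by rewrite /c; lra.
have [r2 r20 hr2] := h_lsc ch.
pose r := Num.min r1 (r2 / 2).
have r0 : 0 < r by rewrite lt_min r10 divr_gt0.
have rr1 : r <= r1 by rewrite ge_min lexx.
have rr2 : r <= r2 / 2 by rewrite ge_min lexx orbT.
pose N y := enorm (y - x0).
have N0 y : 0 <= N y by exact: enorm_ge0.
have NB y z : N z <= N y + enorm (z - y).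
  by rewrite addrC; exact: ler_distD_enorm.
pose e := Num.min D ((c - c') * r / 2).
have cr0 : 0 < (c - c') * r by rewrite mulr_gt0// subr_gt0.
have e0 : 0 < e by rewrite lt_min D0 divr_gt0.
have eD : e <= D by rewrite ge_min lexx.
have ecr : e <= (c - c') * r / 2 by rewrite ge_min lexx orbT.
have c0 : 0 < c by lra.
pose s := Num.min r (e / 2 / (c + c')).
have cc0 : 0 < c + c' by lra.
have s0 : 0 < s by rewrite lt_min r0 !divr_gt0.
exists [set y | N y < s].
  by apply/nbhs_enormP; exists s.
exists (e / 2); first by rewrite divr_gt0.
move=> t u Dt [uf [k [l [kl uk]]]] ut.
(* The cone that raises u near x0. *)
pose psi y := f x0 - t + e - c * N y.
have psi_lip : elip c psi.
  move=> x y; rewrite /psi (_ : _ - _ = c * (N y - N x)); last by ring.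
  rewrite normrM (gtr0_norm c0); apply: ler_wpM2l; first exact: ltW.
  rewrite ler_norml.
  by have := NB x y; have := NB y x; rewrite (enormB y x) => *; apply/andP; split; lra.
have fN y : N y < r -> f x0 - c' * N y <= f y <= f x0 + c' * N y.
  move=> yr; have /fr1 : enorm (y - x0) < r1 by exact: lt_le_trans yr rr1.
  rewrite ler_norml -/(N y) => /andP[? ?]; apply/andP; split; lra.
have psif y : N y < r -> psi y <= f y.
  move=> /fN/andP[h1 _]; rewrite /psi.
  have : c' * N y <= c * N y by rewrite ler_wpM2r// ltW.
  lra.
have psiu y : N y < r -> r / 2 <= N y -> psi y <= u y.
  move=> /fN/andP[h1 _] h2; apply: le_trans (ut y); rewrite /psi.
  have : (c - c') * (r / 2) <= (c - c') * N y by rewrite ler_wpM2l// subr_ge0 ltW.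
  lra.
pose v y := if N y < r then Num.max (u y) (psi y) else u y.
exists v; last first.
  split=> [y|y ys]; first by rewrite /v; case: ifP => // _; rewrite le_max lexx.
  have yr : N y < r by apply: lt_le_trans ys _; rewrite ge_min lexx.
  rewrite /v yr le_max; apply/orP; right; rewrite /psi.
  have /andP[_ h2] := fN y yr.
  have : (c + c') * N y <= e / 2.
    rewrite mulrC -ler_pdivlMr//; apply: le_trans (ltW ys) _.
    by rewrite ge_min lexx orbT.
  lra.
(* A Lipschitz bump, equal to c on the ball of radius r, where the cone may be
   used, and vanishing outside the ball of radius 2 * r, where h exceeds c. *)
pose k' y := c * Num.max 0 (Num.min 1 (2 - N y / r)).
split.
  move=> y; have /andP[u0 u1] := uf y; rewrite /v; case: ifP => [yr|_]; last exact: uf.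
  by rewrite le_max u0 /= ge_max u1 psif.
exists (fun y => Num.max (k y) (k' y)), (Num.max l (c / r)); split.
  apply: elip_max => // x y.
  rewrite -mulrBr normrM (gtr0_norm c0) -[leRHS]mulrA.
  apply: ler_wpM2l; first exact: ltW.
  apply: (@le_trans _ _ (`|N x / r - N y / r|)).
    apply: le_trans (ler_dist_max _ _ _) _; apply: le_trans (ler_dist_min _ _ _) _.
    by rewrite opprD addrACA subrr add0r -opprD normrN.
  rewrite -mulrBl normrM (@gtr0_norm _ r^-1) ?invr_gt0// mulrC.
  apply: ler_wpM2l; first by rewrite invr_ge0 ltW.
  rewrite ler_norml; have := NB x y; have := NB y x.
  by rewrite (enormB y x) => *; apply/andP; split; lra.
move=> y; have [/andP[k0 kh] us] := uk y.
split.
  rewrite le_max k0 /= ge_max kh /=.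
  rewrite /k'; have [yr|yr] := ltP (N y) r2.
    apply: (@le_trans _ _ c); last exact/ltW/hr2.
    rewrite -[leRHS]mulr1 ler_wpM2l ?(ltW c0)// ge_max ler01/=.
    by rewrite ge_min lexx.
  rewrite max_l ?mulr0//.
  rewrite ge_min; apply/orP; right; rewrite subr_le0 ler_pdivlMr//.
  by move: rr2 yr; lra.
rewrite /v; have [yr|yr] := ltP (N y) r.
  apply: (@slope_le_near _ _ _ (fun z => Num.max (u z) (psi z))).
    exists (r - N y); first by rewrite subr_gt0.
    by move=> z zy; rewrite (_ : N z < r)//; have := NB y z; lra.
  apply: slope_le_max.
    by apply: slope_leW us; rewrite le_max lexx.
  apply: slope_leW (elip_slope psi_lip _).
  rewrite le_max; apply/orP; right; rewrite /k' (_ : Num.max _ _ = 1) ?mulr1//.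
  have : N y / r <= 1 by rewrite ler_pdivrMr// mul1r ltW.
  by move=> ?; rewrite min_l ?max_r//; lra.
apply: (@slope_le_near _ _ _ u); last first.
  by apply: slope_leW us; rewrite le_max lexx.
exists (r / 2); first by rewrite divr_gt0.
move=> z zy; case: ifP => // zr; rewrite max_l// psiu//.
by have := NB z y; rewrite enormB; lra.
Qed.

Hypothesis f0 : forall x, 0 <= f x.

(** By compactness of the support, the gain of the local bumps is uniform: from
    f - t <= u one passes to f - (t - e) <= v with the same e for all t >= D. The
    zero function is a start, with t = M. *)
Lemma relaxation (M rho D : R) : 0 < D -> (forall x, f x <= M) ->
  (forall x, rho < enorm x -> f x = 0) ->
  exists2 u, relaxed u & forall x, f x - D <= u x.
Proof.
move=> D0 fM frho.
pose P (A : set 'rV[R]_d) :=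
  exists2 eta, 0 < eta & forall t u, D <= t -> relaxed u ->
    (forall y, f y - t <= u y) ->
    exists2 v, relaxed v & (forall y, u y <= v y) /\
      forall y, A y -> f y - t + eta <= v y.
have [eta eta0 H] : P [set x | enorm x <= rho].
  apply: compact_local_to_global.
  - exact: compact_enorm_ball.
  - by exists 1 => // t u _ uH _; exists u.
  - move=> A B [e1 e10 H1] [e2 e20 H2].
    exists (Num.min e1 e2) => [|t u Dt uH ut]; first by rewrite lt_min e10.
    have [v vH [uv Av]] := H1 t u Dt uH ut.
    have [w wH [uw Bw]] := H2 t u Dt uH ut.
    exists (fun x => Num.max (v x) (w x)); first exact: relaxed_max.
    split=> [y|y [/Av|/Bw] h1]; rewrite le_max.
    + by rewrite uv.
    + apply/orP; left; apply: le_trans h1; rewrite lerD2l.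
      by rewrite ge_min lexx.
    + apply/orP; right; apply: le_trans h1; rewrite lerD2l.
      by rewrite ge_min lexx orbT.
  - move=> A B AB [e1 e10 H1]; exists e1 => // t u Dt uH ut.
    have [v vH [uv Av]] := H1 t u Dt uH ut.
    by exists v => //; split => // y /AB/Av.
  - by move=> x _; exact: relaxed_bump.
pose e := Num.min eta D.
have e0 : 0 < e by rewrite lt_min eta0.
have step t u : D <= t -> relaxed u -> (forall y, f y - t <= u y) ->
    exists2 v, relaxed v & forall y, f y - (t - e) <= v y.
  move=> Dt uH ut; have [v vH [uv Kv]] := H t u Dt uH ut.
  exists v => // y.
  have [/Kv|/frho fy] := leP (enorm y) rho.
    have : e <= eta by rewrite ge_min lexx.
    lra.
  have : e <= D by rewrite ge_min lexx orbT.
  have /andP[+ _] := vH.1 y; rewrite fy; lra.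
have iter n : exists2 u, relaxed u &
    forall y, f y - Num.max D (M - n%:R * e) <= u y.
  elim: n => [|n [u uH ut]].
    exists (fun=> 0).
      split=> [x|]; first by rewrite lexx f0.
      exists (fun=> 0), 0; split=> [x y|x]; first by rewrite subrr normr0 mul0r.
      split; first by rewrite lexx h0.
      by apply: elip_slope => y z; rewrite subrr normr0 mul0r.
    by move=> y; rewrite mul0r subr0 subr_le0 le_max fM orbT.
  have [|v vH vt] := step _ _ _ uH ut; first by rewrite le_max lexx.
  exists v => // y; apply: le_trans (vt y).
  rewrite lerD2l lerN2 -natr1 mulrDl mul1r.
  by rewrite /Num.max; repeat case: ltP => ?; lra.
have [n nM] : exists n : nat, M / e <= n%:R.
  exists (Num.bound `|M / e|); apply: le_trans (ler_norm _) _.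
  by apply/ltW/archi_boundP.
have [u uH ut] := iter n; exists u => // x; apply: le_trans (ut x).
rewrite lerD2l lerN2 ge_max lexx /=.
by move: nM; rewrite ler_pdivrMr//; lra.
Qed.

End relaxation.

(** * Means of continuous functions over an interval *)

Section interval_mean.
Context {R : realType}.
Implicit Types (phi psi : R -> R) (s t e : R).
Local Notation leb := (@lebesgue_measure R).

Definition itv_mean e phi : R := e^-1 * \int[leb]_(t in `[0, e]) phi t.

Variable e : R.
Hypothesis e0 : 0 < e.

Lemma continuous_integrable_itv phi : continuous phi ->
  leb.-integrable `[0, e] (EFin \o phi).
Proof.
move=> cphi; apply: continuous_compact_integrable; first exact: segment_compact.
exact: continuous_subspaceT.
Qed.

Lemma itv_mean_cst (b : R) : itv_mean e (fun=> b) = b.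
Proof.
rewrite /itv_mean Rintegral_cst//= lebesgue_measure_itv/= lte_fin e0.
by rewrite -EFinD/= subr0 mulrCA mulVf ?mulr1// gt_eqF.
Qed.

Lemma itv_meanB phi psi : continuous phi -> continuous psi ->
  itv_mean e (fun t => phi t - psi t) = itv_mean e phi - itv_mean e psi.
Proof.
by move=> cphi cpsi; rewrite /itv_mean RintegralB ?mulrBr//;
  exact: continuous_integrable_itv.
Qed.

Lemma itv_meanZ phi (a : R) : continuous phi ->
  itv_mean e (fun t => a * phi t) = a * itv_mean e phi.
Proof.
move=> cphi; rewrite /itv_mean RintegralZl//; first by rewrite mulrCA.
exact: continuous_integrable_itv.
Qed.

Lemma itv_mean_sum (I : Type) (r : seq I) (phi : I -> R -> R) :
  (forall i, continuous (phi i)) ->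
  itv_mean e (fun t => \sum_(i <- r) phi i t) = \sum_(i <- r) itv_mean e (phi i).
Proof.
move=> cphi; elim: r => [|i r IH].
  under [X in itv_mean e X]eq_fun do rewrite big_nil.
  by rewrite itv_mean_cst big_nil.
have cs : continuous (fun t => \sum_(i <- r) phi i t).
  move=> t; elim: (r) => [|j s IHs].
    by under eq_fun do rewrite big_nil; exact: cst_continuous.
  by under eq_fun do rewrite big_cons; apply: continuousD => //; exact: cphi.
under [X in itv_mean e X]eq_fun do rewrite big_cons.
rewrite big_cons -IH /itv_mean RintegralD ?mulrDr//;
  exact: continuous_integrable_itv.
Qed.

Lemma itv_mean_near phi (b c : R) : continuous phi ->
  (forall t, 0 <= t <= e -> `|phi t - b| <= c) -> `|itv_mean e phi - b| <= c.
Proof.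
move=> cphi H; rewrite -[b in X in X <= _]itv_mean_cst -itv_meanB//; last exact: cst_continuous.
have cpb : continuous (fun t => phi t - b).
  by move=> t; apply: continuousB; [exact: cphi|exact: cst_continuous].
rewrite /itv_mean normrM gtr0_norm ?invr_gt0// mulrC ler_pdivrMr//.
apply: (le_trans (le_normr_Rintegral _ _)) => //.
  exact: continuous_integrable_itv.
rewrite (_ : c * e = \int[leb]_(t in `[0, e]) c); last first.
  by rewrite Rintegral_cst//= lebesgue_measure_itv/= lte_fin e0 -EFinD/= subr0.
apply: le_Rintegral => //.
- apply: continuous_integrable_itv => t.
  apply: (@continuous_comp _ _ _ (fun t => phi t - b) (@Num.norm _ R)).
    exact: cpb.
  exact: norm_continuous.
- by apply: continuous_integrable_itv => t; exact: cst_continuous.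
Qed.

Lemma itv_mean_dist phi psi (c : R) : continuous phi -> continuous psi ->
  (forall t, 0 <= t <= e -> `|phi t - psi t| <= c) ->
  `|itv_mean e phi - itv_mean e psi| <= c.
Proof.
move=> cphi cpsi H; rewrite -itv_meanB// -[X in `|X|]subr0.
apply: itv_mean_near => [t|t te]; last by rewrite subr0; exact: H.
by apply: continuousB; [exact: cphi|exact: cpsi].
Qed.

Lemma continuous_antiderivative phi (N : R) : continuous phi -> 0 < N ->
  exists F : R -> R, forall x : R, - N < x < N -> is_derive x 1 F (phi x).
Proof.
move=> cphi N0.
exists (fun x => \int[leb]_(t in `[- N, x]) phi t) => x /andP[Nx xN].
have [|dF F'] := @continuous_FTC1_closed R phi (- N) x N xN _ Nx (cphi x).
  apply: continuous_compact_integrable; first exact: segment_compact.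
  exact: continuous_subspaceT.
apply: (DeriveDef dF); by rewrite -[LHS]derive1E F'.
Qed.

Lemma is_derive_translate (F : R -> R) (x s a : R) : is_derive (x + s) 1 F a ->
  is_derive x 1 (fun t => F (t + s)) a.
Proof.
move=> dF; rewrite -[a]mulr1.
exact: (@is_derive1_comp _ F (shift s) x a 1 dF (is_derive_shift _ _ _)).
Qed.

(** With F an antiderivative of phi, the mean of the translate by s is
    (F (e + s) - F s) / e, whose derivative in s is (phi (e + s) - phi s) / e. The
    mean value theorem and the Lipschitz bound of phi give the quadratic error. *)
Lemma itv_mean_translate phi (L : R) s :
  (forall t t', `|phi t - phi t'| <= L * `|t - t'|) -> continuous phi ->
  `|itv_mean e (fun t => phi (t + s)) - itv_mean e phi - s * ((phi e - phi 0) / e)|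
    <= 2 * L / e * s ^+ 2.
Proof.
move=> phiL cphi.
have [F dF] : exists F : R -> R, forall x : R,
    - (`|s| + e + 1) < x < `|s| + e + 1 -> is_derive x 1 F (phi x).
  by apply: continuous_antiderivative => //; rewrite ltr_wpDl// addr_ge0// ltW.
have FE r : `|r| <= `|s| -> itv_mean e (fun t => phi (t + r)) = e^-1 * (F (e + r) - F r).
  move=> rs; rewrite /itv_mean; congr (_ * _).
  have dFr x : 0 <= x <= e -> is_derive x 1 (fun t => F (t + r)) (phi (x + r)).
    move=> xe; apply: is_derive_translate; apply: dF.
    by move: rs xe; rewrite ler_norml => rs xe; apply/andP; split; lra.
  have cont x : 0 <= x <= e -> {for x, continuous (fun t => F (t + r))}.
    move=> /dFr dx; apply/differentiable_continuous/derivable1_diffP.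
    exact: (@ex_derive _ _ _ _ _ _ _ dx).
  rewrite /Rintegral (@continuous_FTC2 _ _ (fun t => F (t + r)))//=.
  - by rewrite add0r.
  - apply: continuous_subspaceT => t; apply: continuous_comp; last exact: cphi.
    by apply: continuousD => //; exact: cst_continuous.
  - split.
    + move=> x; rewrite in_itv/= => /andP[x0 xe].
      have dx := dFr x; apply: (@ex_derive _ _ _ _ _ _ _ (dx _)).
      by rewrite !ltW.
    + by apply: cvg_at_right_filter; apply: cont; rewrite lexx ltW.
    + by apply: cvg_at_left_filter; apply: cont; rewrite lexx ltW.
  - move=> x; rewrite in_itv/= => /andP[x0 xe].
    have dx : is_derive x 1 (fun t => F (t + r)) (phi (x + r)).
      by apply: dFr; rewrite !ltW.
    by rewrite derive1E derive_val.
have -> : itv_mean e phi = e^-1 * (F (e + 0) - F 0).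
  rewrite -FE ?normr0//; congr (itv_mean _ _); apply/funext => t.
  by rewrite addr0.
rewrite FE//.
pose G (r : R) : R := F (r + e) - F r.
have dG (r : R) : `|r| <= `|s| -> is_derive r 1 G (phi (r + e) - phi r).
  rewrite ler_norml => rs; apply: is_deriveB.
    apply: is_derive_translate; apply: dF; have := e0; move=> ?; apply/andP; split; lra.
  by apply: dF; have := e0; move=> ?; apply/andP; split; lra.
have [r rs Gs] : exists2 r : R, `|r| <= `|s| & G s - G 0 = (phi (r + e) - phi r) * s.
  have [s0|s0] := leP 0 s.
    have [||r] := @MVT_segment _ G (fun r => phi (r + e) - phi r) 0 s s0.
    - move=> r; rewrite in_itv/= => /andP[r0 rs]; apply: dG.
      by rewrite (ger0_norm s0) (ger0_norm (ltW r0)) ltW.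
    - apply: derivable_within_continuous => r; rewrite in_itv/= => /andP[r0 rs].
      have dr := dG r; apply: (@ex_derive _ _ _ _ _ _ _ (dr _)).
      by rewrite (ger0_norm s0) (ger0_norm r0).
    - rewrite in_itv/= subr0 => /andP[r0 rs] Gr; exists r => //.
      by rewrite (ger0_norm s0) (ger0_norm r0).
  have [||r] := @MVT_segment _ G (fun r => phi (r + e) - phi r) s 0 (ltW s0).
  - move=> r; rewrite in_itv/= => /andP[r0 rs]; apply: dG.
    by rewrite (ltr0_norm s0) (ltr0_norm rs) lerN2 ltW.
  - apply: derivable_within_continuous => r; rewrite in_itv/= => /andP[r0 rs].
    have dr := dG r; apply: (@ex_derive _ _ _ _ _ _ _ (dr _)).
    by rewrite (ltr0_norm s0) (ler0_norm rs) lerN2.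
  - rewrite in_itv/= => /andP[r0 rs] Gr; exists r.
      by rewrite (ltr0_norm s0) (ler0_norm rs) lerN2.
    by move: Gr; lra.
have -> : e^-1 * (F (e + s) - F s) - e^-1 * (F (e + 0) - F 0) -
   s * ((phi e - phi 0) / e) = e^-1 * (s * ((phi (r + e) - phi e) - (phi r - phi 0))).
  rewrite -mulrBr (_ : F (e + s) - F s - (F (e + 0) - F 0) = G s - G 0).
    by rewrite Gs; ring.
  by rewrite /G add0r addr0 (addrC e).
rewrite normrM gtr0_norm ?invr_gt0//.
rewrite (_ : 2 * L / e * s ^+ 2 = e^-1 * (2 * L * s ^+ 2)); last by ring.
rewrite ler_pM2l ?invr_gt0//.
rewrite normrM -[s ^+ 2]real_normK ?num_real// expr2.
have h1 := phiL (r + e) e; have h2 := phiL r 0.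
have h3 := ler_normB (phi (r + e) - phi e) (phi r - phi 0).
rewrite addrK in h1; rewrite subr0 in h2.
have h4 : `|(phi (r + e) - phi e) - (phi r - phi 0)| <= 2 * (L * `|r|) by lra.
have L0 : 0 <= L.
  by have := phiL 1 0; rewrite subr0 normr1 mulr1; apply: le_trans.
have h5 : 2 * (L * `|r|) <= 2 * (L * `|s|).
  by rewrite ler_wpM2l// ler_wpM2l.
apply: (@le_trans _ _ (`|s| * (2 * (L * `|s|)))).
  by rewrite ler_wpM2l// (le_trans h4).
by rewrite le_eqVlt; apply/orP; left; apply/eqP; ring.
Qed.

End interval_mean.

(** * Mollification *)

Section mollification.
Context {R : realType} {d : nat}.
Implicit Types (x y z h : 'rV[R]_d) (u w : 'rV[R]_d -> R).
Implicit Types (g : 'rV[R]_d -> 'rV[R]_d).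

Definition dir_mean (e : R) (j : 'I_d) u x : R :=
  itv_mean e (fun t => u (x + t *: delta_mx 0 j)).

(** A second order Taylor estimate in the directions of the first m coordinates.
    Being uniform in x and closed, it is preserved by averaging over
    translations. *)
Definition taylor_le (m : nat) u g (l : R) := forall x h,
  (forall i : 'I_d, (m <= i)%N -> h 0 i = 0) ->
  `|u (x + h) - u x - dotv h (g x)| <= l * enorm h ^+ 2.

Definition elip_field (l : R) g := forall i, elip l (fun x => g x 0 i).

(** What is needed of the fact that w x is a mean of values of u at distance at
    most rho from x, with the same weights for all x. It composes without any
    mention of the averaging measure. *)
Definition averages (rho : R) u w :=
  (forall x b c, (forall z, enorm (z - x) <= rho -> `|u z - b| <= c) ->
    `|w x - b| <= c) /\
  (forall x x' c, (forall z, enorm z <= rho -> `|u (x + z) - u (x' + z)| <= c) ->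
    `|w x - w x'| <= c).

Lemma enorm_delta (j : 'I_d) : enorm (delta_mx 0 j : 'rV[R]_d) = 1.
Proof.
rewrite /enorm /dotv (bigD1 j)//= big1 ?addr0 => [|i ij].
  by rewrite mxE !eqxx mulr1 sqrtr1.
by rewrite mxE (negPf ij) andbF mulr0.
Qed.

Lemma elip_continuous (l : R) u : elip l u -> continuous u.
Proof.
move=> ul x; apply/(@cvgrPdist_le _ _ _ _ (nbhs_filter x)) => e e0.
apply/nbhs_enormP; exists (e / (`|l| + 1)); first by rewrite divr_gt0// ltr_wpDl.
move=> y; rewrite ltr_pdivlMr ?ltr_wpDl// => h1.
apply: le_trans (ul _ _) _; rewrite enormB.
have h2 : l * enorm (y - x) <= `|l| * enorm (y - x).
  by rewrite ler_wpM2r// ler_norm.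
have := enorm_ge0 (y - x); lra.
Qed.

Lemma elip_line (l : R) u x j : elip l u -> forall t t' : R,
  `|u (x + t *: delta_mx 0 j) - u (x + t' *: delta_mx 0 j)| <= l * `|t - t'|.
Proof.
move=> ul t t'; apply: le_trans (ul _ _) _.
by rewrite opprD addrACA subrr add0r -scalerBl enormZ enorm_delta mulr1.
Qed.

Lemma lipschitz1_continuous (phi : R -> R) (l : R) :
  (forall t t' : R, `|phi t - phi t'| <= l * `|t - t'|) -> continuous phi.
Proof.
move=> ul x; apply/cvgrPdist_le => e e0.
apply/nbhs_ballP; exists (e / (`|l| + 1)); first by rewrite /= divr_gt0// ltr_wpDl.
move=> y; rewrite /ball/= ltr_pdivlMr ?ltr_wpDl// => h1.
apply: le_trans (ul _ _) _.
have h2 : l * `|x - y| <= `|l| * `|x - y|.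
  by rewrite ler_wpM2r// ler_norm.
have := normr_ge0 (x - y); lra.
Qed.

Lemma elip_line_continuous (l : R) u x j : elip l u ->
  continuous (fun t : R => u (x + t *: delta_mx 0 j)).
Proof. by move=> /elip_line ul; apply: lipschitz1_continuous; exact: ul. Qed.

Lemma enorm_dotv_field (l : R) g x y h : elip_field l g ->
  `|dotv h (g x) - dotv h (g y)| <= d%:R * (enorm h * (l * enorm (x - y))).
Proof.
move=> gl; rewrite -dotvBr /dotv; apply: le_trans (ler_norm_sum _ _ _) _.
have -> : d%:R * (enorm h * (l * enorm (x - y))) =
    \sum_(i < d) (enorm h * (l * enorm (x - y))).
  by rewrite sumr_const card_ord mulr_natl.
apply: ler_sum => i _; rewrite normrM ler_pM//; first exact: norm_coord_le_enorm.
by rewrite !mxE; exact: gl.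
Qed.

Lemma dir_mean_averages (e L : R) j u : 0 < e -> elip L u ->
  averages e u (dir_mean e j u).
Proof.
move=> e0 uL; split=> [x b c H|x x' c H].
  apply: itv_mean_near => //; first exact: elip_line_continuous uL.
  move=> t /andP[t0 te]; apply: H.
  by rewrite addrAC subrr add0r enormZ enorm_delta mulr1 ger0_norm.
apply: itv_mean_dist => //; try exact: elip_line_continuous uL.
move=> t /andP[t0 te]; apply: H.
by rewrite enormZ enorm_delta mulr1 ger0_norm.
Qed.

Lemma averages_trans (r s : R) u v w : averages r u v -> averages s v w ->
  averages (r + s) u w.
Proof.
move=> [uv1 uv2] [vw1 vw2]; split=> [x b c H|x x' c H].
  apply: vw1 => z zx; apply: uv1 => y yz; apply: H.
  exact: le_trans (ler_distD_enorm z _ _) (lerD yz zx).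
apply: vw2 => z zs; apply: uv2 => y yr; rewrite -!addrA; apply: H.
by rewrite addrC (le_trans (ler_enormD _ _))// lerD.
Qed.

Lemma averages_elip (r L : R) u w : elip L u -> averages r u w -> elip L w.
Proof.
move=> uL [_ H] x y; apply: H => z _; apply: le_trans (uL _ _) _.
by rewrite opprD addrACA subrr addr0.
Qed.

(** For an increment h with coordinates up to j, split off the component along
    e_j: the mean is differentiable in that direction with derivative G, the
    difference quotient of u over the length e, and in the previous directions the
    derivative is the mean of the one of u. *)
Lemma dir_mean_taylor (e L l : R) (j : 'I_d) u g : 0 < e ->
  elip L u -> elip_field l g -> taylor_le j u g l ->
  exists g' l', elip_field l' g' /\ taylor_le j.+1 (dir_mean e j u) g' l'.
Proof.
move=> e0 uL gl ug.
pose ej : 'rV[R]_d := delta_mx 0 j.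
pose G x := (u (x + e *: ej) - u x) / e.
have GL : elip (2 * L / e) G.
  move=> x y; rewrite /G -mulrBl normrM (@gtr0_norm _ e^-1) ?invr_gt0//.
  rewrite mulrAC; apply: ler_wpM2r; first by rewrite invr_ge0 ltW.
  have h1 := uL (x + e *: ej) (y + e *: ej); have h2 := uL x y.
  rewrite opprD addrACA subrr addr0 in h1.
  have -> : u (x + e *: ej) - u x - (u (y + e *: ej) - u y) =
    (u (x + e *: ej) - u (y + e *: ej)) - (u x - u y) by ring.
  have := ler_normB (u (x + e *: ej) - u (y + e *: ej)) (u x - u y); lra.
pose g' x : 'rV[R]_d := \row_i (if i == j then G x else dir_mean e j (fun z => g z 0 i) x).
pose A := `|l|; pose B := `|L| / e.
have A0 : 0 <= A by exact: normr_ge0.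
have B0 : 0 <= B by rewrite divr_ge0// ltW.
have lA : l <= A by exact: ler_norm.
have LB : 2 * L / e <= 2 * B.
  by rewrite /B mulrA ler_wpM2r ?invr_ge0 ?(ltW e0)// ler_wpM2l// ler_norm.
exists g', (5 * A + 8 * B); split.
  move=> i x y; rewrite !mxE; case: ifP => _.
    by apply: le_trans (GL _ _) _; rewrite ler_wpM2r//; lra.
  have := averages_elip (gl i) (dir_mean_averages j e0 (gl i)).
  by move=> /(_ x y)/le_trans; apply; rewrite ler_wpM2r//; lra.
move=> x h hj.
pose s := h 0 j.
pose h' := h - s *: ej.
have h'j : h' 0 j = 0 by rewrite /h' !mxE !eqxx mulr1 subrr.
have h'i i : i != j -> h' 0 i = h 0 i.
  by move=> ij; rewrite /h' !mxE (negPf ij) andbF mulr0 subr0.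
have h'0 (i : 'I_d) : (j <= i)%N -> h' 0 i = 0.
  have [->//|ij] := eqVneq i j; rewrite leq_eqVlt => /predU1P[/val_inj ji|ji].
    by rewrite ji eqxx in ij.
  by rewrite h'i// hj.
have sh : `|s| <= enorm h by exact: norm_coord_le_enorm.
have h'h : enorm h' <= 2 * enorm h.
  rewrite /h' (le_trans (ler_enormD _ _))// enormN enormZ enorm_delta mulr1.
  lra.
pose gA x : 'rV[R]_d := \row_i dir_mean e j (fun z => g z 0 i) x.
have dotE : dotv h (g' x) = dotv h' (gA x) + s * G x.
  rewrite /dotv (bigD1 j)//= [in RHS](bigD1 j)//= h'j mul0r add0r addrC.
  rewrite !mxE eqxx; congr (_ + _); apply: eq_bigr => i ij.
  by rewrite h'i// !mxE (negPf ij).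
have meanE : dotv h' (gA x) = itv_mean e (fun t => dotv h' (g (x + t *: ej))).
  rewrite /dotv itv_mean_sum//; last first.
    move=> i t; apply: continuousM; first exact: cst_continuous.
    exact: (@elip_line_continuous l (fun z => g z 0 i) x j (gl i) t).
  apply: eq_bigr => i _; rewrite itv_meanZ//; first by rewrite [gA x 0 i]mxE.
  move=> t; exact: (@elip_line_continuous l (fun z => g z 0 i) x j (gl i) t).
have contg : continuous (fun t : R => dotv h' (g (x + t *: ej))).
  apply: (@lipschitz1_continuous _ (d%:R * (enorm h' * l))) => t t'.
  apply: le_trans (enorm_dotv_field _ _ _ gl) _.
  rewrite opprD addrACA subrr add0r -scalerBl enormZ enorm_delta mulr1.
  by rewrite !mulrA.
have cu z : continuous (fun t : R => u (z + t *: ej)).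
  exact: elip_line_continuous uL.
have E1 : `|dir_mean e j u (x + h') - dir_mean e j u x - dotv h' (gA x)| <=
    l * enorm h' ^+ 2.
  have cB : continuous (fun t : R => u (x + h' + t *: ej) - u (x + t *: ej)).
    move=> t; exact: (continuousB (cu (x + h') t) (cu x t)).
  rewrite meanE /dir_mean -itv_meanB//; try exact: cu.
  rewrite -itv_meanB// -[X in `|X|]subr0; apply: itv_mean_near => //.
    move=> t; exact: (continuousB (cB t) (contg t)).
  by move=> t _; rewrite subr0 (addrAC x h'); exact: ug.
have E2 : `|dir_mean e j u (x + h) - dir_mean e j u (x + h') - s * G (x + h')| <=
    2 * L / e * s ^+ 2.
  have := @itv_mean_translate R e e0 (fun t => u (x + h' + t *: ej)) L s
    (@elip_line L u (x + h') j uL) (cu (x + h')).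
  rewrite /= scale0r addr0 -/(G (x + h')) /dir_mean.
  rewrite (_ : (fun t => u (x + h + t *: ej)) =
    (fun t => u (x + h' + (t + s) *: ej)))//.
  apply/funext => t; congr u; rewrite /h' scalerDl [in RHS](addrC (t *: ej)).
  by rewrite !addrA subrK.
have E3 : `|s * G (x + h') - s * G x| <= `|s| * (2 * L / e * enorm h').
  rewrite -mulrBr normrM ler_wpM2l// (le_trans (GL _ _))//.
  by rewrite addrAC subrr add0r.
rewrite dotE; set w := dir_mean e j u in E1 E2 *.
rewrite (_ : _ - _ = (w (x + h) - w (x + h') - s * G (x + h')) +
  (w (x + h') - w x - dotv h' (gA x)) + (s * G (x + h') - s * G x)); last by ring.
apply: le_trans (ler_normD _ _) _.
apply: le_trans (lerD (le_trans (ler_normD _ _) (lerD E2 E1)) E3) _.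
pose H := enorm h; have H0 : 0 <= H by exact: enorm_ge0.
have h'H : enorm h' ^+ 2 <= (2 * H) ^+ 2 by rewrite lerXn2r ?nnegrE// mulr_ge0.
have sH : s ^+ 2 <= H ^+ 2.
  by rewrite -[s ^+ 2]real_normK ?num_real// lerXn2r ?nnegrE.
have F1 : 2 * L / e * s ^+ 2 <= 2 * B * H ^+ 2.
  apply: (@le_trans _ _ (2 * B * s ^+ 2)); first by rewrite ler_wpM2r// sqr_ge0.
  by apply: ler_wpM2l => //; rewrite mulr_ge0.
have F2 : l * enorm h' ^+ 2 <= A * (2 * H) ^+ 2.
  apply: (@le_trans _ _ (A * enorm h' ^+ 2)); first by rewrite ler_wpM2r// sqr_ge0.
  by rewrite ler_wpM2l.
have F3 : `|s| * (2 * L / e * enorm h') <= H * (2 * B * (2 * H)).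
  apply: (@le_trans _ _ (`|s| * (2 * B * (2 * H)))).
    apply: ler_wpM2l => //; apply: (@le_trans _ _ (2 * B * enorm h')).
      by rewrite ler_wpM2r.
    by apply: ler_wpM2l => //; rewrite mulr_ge0.
  have BH : 0 <= 2 * B * (2 * H) by rewrite mulr_ge0// mulr_ge0.
  by rewrite ler_wpM2r.
have F4 : 0 <= A * H ^+ 2 by rewrite mulr_ge0// sqr_ge0.
have F5 : 0 <= B * H ^+ 2 by rewrite mulr_ge0// sqr_ge0.
rewrite -/H; lra.
Qed.

(** The test functions. The quantitative Taylor estimate replaces
    differentiability with a Lipschitz gradient: it can be integrated over
    translations, so that conditional means of test functions are test
    functions. *)
Definition C11 u g := (exists M : R, forall x, `|u x| <= M) /\
  exists l : R, [/\ 0 <= l, elip l u, elip_field l g &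
    forall x h, `|u (x + h) - u x - dotv h (g x)| <= l * enorm h ^+ 2].

Lemma mollify (L rho : R) u : 0 < rho -> elip L u -> exists w g l,
  [/\ elip L w, elip_field l g, taylor_le d w g l & averages rho u w].
Proof.
move=> rho0 uL.
pose e := rho / d.+1%:R.
have e0 : 0 < e by rewrite divr_gt0.
have H n : (n <= d)%N -> exists w g l,
    [/\ elip L w, elip_field l g, taylor_le n w g l & averages (n%:R * e) u w].
  elim: n => [_|n IH nd].
    exists u, (fun=> 0), 0; split => //.
    - by move=> i x y; rewrite subrr normr0 mul0r.
    - move=> x h h0; rewrite (_ : h = 0); last first.
        by apply/rowP => i; rewrite h0// mxE.
      by rewrite addr0 subrr /dotv big1 ?subrr ?normr0 ?mul0r// => i _; rewrite mxE mul0r.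
    - split=> [x b c|x x' c] H.
        by apply: H; rewrite subrr enorm0 mul0r.
      by have := H 0; rewrite !addr0 enorm0 mul0r; exact.
  have [w [g [l [wL gl wg uw]]]] := IH (ltnW nd).
  have [g' [l' [gl' wg']]] := @dir_mean_taylor e L l (Ordinal nd) w g e0 wL gl wg.
  have ww := dir_mean_averages (Ordinal nd) e0 wL.
  exists (dir_mean e (Ordinal nd) w), g', l'; split => //.
    exact: averages_elip ww.
  by rewrite -natr1 mulrDl mul1r; exact: averages_trans uw ww.
have [w [g [l [wL gl wg [uw1 uw2]]]]] := H d (leqnn d).
have de : d%:R * e <= rho.
  by rewrite /e mulrA ler_pdivrMr// mulrC ler_wpM2l ?(ltW rho0)// ler_nat.
exists w, g, l; split => //; split=> [x b c H1|x x' c H1].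
  by apply: uw1 => z /le_trans/(_ de); exact: H1.
by apply: uw2 => z /le_trans/(_ de); exact: H1.
Qed.

(** On the ball of radius 2 * rho around x, the slope of u is at most
    k x + 2 * l * rho; so u, and therefore its mollification w, is Lipschitz with
    this constant near x, and the Taylor estimate turns this into a bound of the
    gradient. *)
Lemma smooth_approximation (M S l e : R) u k : 0 < e -> 0 <= l -> 0 <= S ->
  (forall x, `|u x| <= M) -> elip l k -> (forall x, 0 <= k x <= S) ->
  (forall x, slope_le u x (k x)) ->
  exists w g, [/\ C11 w g, forall x, `|w x - u x| <= e &
    forall x, enorm (g x) <= k x + e].
Proof.
move=> e0 l0 S0 uM kl kS uk.
have uS : elip S u.
  move=> x y; apply: slope_le_segment => t _; apply: slope_leW (uk _).
  by have /andP[] := kS (y + t *: (x - y)).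
(* The first constraint controls |w - u|, the second one the oscillation of k. *)
pose rho := Num.min (e / (S + 1)) (e / (2 * l + 1)).
have S1 : 0 < S + 1 by lra.
have l1 : 0 < 2 * l + 1 by lra.
have rho0 : 0 < rho by rewrite lt_min !divr_gt0.
have rhoS : rho * (S + 1) <= e by rewrite -ler_pdivlMr// ge_min lexx.
have rhol : rho * (2 * l + 1) <= e by rewrite -ler_pdivlMr// ge_min lexx orbT.
have [w [g [L [wS gL wg [uw1 uw2]]]]] := mollify rho0 uS.
have uw x : `|w x - u x| <= e.
  apply: uw1 => z zx; apply: le_trans (uS _ _) _.
  have : S * enorm (z - x) <= S * rho by rewrite ler_wpM2l.
  lra.
exists w, g; split=> //.
  split.
    exists (M + e) => x; have := ler_normD (w x - u x) (u x); rewrite subrK.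
    by have := uw x; have := uM x; lra.
  exists (Num.max S L); split.
  - by rewrite le_max S0.
  - by move=> x y; apply: le_trans (wS x y) _; rewrite ler_wpM2r// le_max lexx.
  - by move=> i x y; apply: le_trans (gL i x y) _; rewrite ler_wpM2r// le_max lexx orbT.
  - move=> x h; apply: le_trans (wg x h _) _.
      by move=> i; rewrite leqNgt ltn_ord.
    by rewrite ler_wpM2r ?sqr_ge0// le_max lexx orbT.
move=> x; pose c := k x + e.
have wc y : enorm (y - x) <= rho -> `|w y - w x| <= c * enorm (y - x).
  move=> yx; apply: uw2 => z zr.
  rewrite (_ : y - x = (y + z) - (x + z)); last by rewrite opprD addrACA subrr addr0.
  apply: slope_le_segment => t /andP[t0 t1]; apply: slope_leW (uk _).
  set p := x + z + _.
  have px : enorm (p - x) <= 2 * rho.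
    rewrite /p (_ : _ - x = z + t *: (y - x)).
      rewrite (le_trans (ler_enormD _ _))// enormZ ger0_norm// mulr_natl mulr2n lerD//.
      by rewrite (le_trans _ yx)// ler_piMl.
    by apply/rowP => i; rewrite !mxE; ring.
  have := kl p x; rewrite ler_norml => /andP[_].
  have : l * enorm (p - x) <= l * (2 * rho) by rewrite ler_wpM2l.
  rewrite /c; lra.
rewrite leNgt; apply/negP => cg; rewrite -/c in cg.
pose G := enorm (g x).
have c0 : 0 <= c by have /andP[kx0 _] := kS x; rewrite /c; lra.
have G0 : 0 < G by exact: le_lt_trans cg.
have LG : 0 < 2 * (`|L| * G + 1).
  by rewrite mulr_gt0// ltr_wpDl// mulr_ge0// ltW.
(* An increment t g small enough to be admissible and to make the second order
   term smaller than the supposed excess G - c. *)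
pose t := Num.min (rho / G) ((G - c) / (2 * (`|L| * G + 1))).
have t0 : 0 < t by rewrite lt_min !divr_gt0// subr_gt0.
have tG : t * G <= rho by rewrite -ler_pdivlMr// ge_min lexx.
have tc : t * (2 * (`|L| * G + 1)) <= G - c.
  by rewrite -ler_pdivlMr// ge_min lexx orbT.
have tgE : enorm (t *: g x) = t * G by rewrite enormZ gtr0_norm.
have := wg x (t *: g x); rewrite tgE => /(_ _)/wrap[].
  by move=> i; rewrite leqNgt ltn_ord.
have := wc (x + t *: g x); rewrite addrAC subrr add0r tgE => /(_ tG).
rewrite dotvZl -enorm_sqr -/G => /ler_normlP[_ h1] /ler_normlP[h2 _].
have h3 : L * (t * G) ^+ 2 <= `|L| * (t * G) ^+ 2.
  by rewrite ler_wpM2r ?sqr_ge0// ler_norm.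
have h4 : t * G * G <= t * G * (c + `|L| * (t * G)) by move: h1 h2 h3; lra.
have tG0 : 0 < t * G by rewrite mulr_gt0.
move: h4; rewrite ler_pM2l// => h4.
have := mulr_ge0 (normr_ge0 L) (ltW tG0); lra.
Qed.

End mollification.

(** * The gradient norm is the local slope *)

Section gradient_norm_slope.
Context {R : realType} {d : nat}.
Implicit Types (x y z h : 'rV[R]_d) (f : 'rV[R]_d -> R).

Lemma differentiable_dotv f x h : differentiable f x ->
  'd f x h = dotv h (gradient f x).
Proof.
move=> dfx; rewrite {1}[h]row_sum_delta linear_sum; apply: eq_bigr => i _.
by rewrite linearZ /= mxE deriveE.
Qed.

Lemma differentiable_taylor f x e : differentiable f x -> 0 < e ->
  exists2 r, 0 < r & forall y, enorm (y - x) < r ->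
    `|f y - f x - dotv (y - x) (gradient f x)| <= e * enorm (y - x).
Proof.
move=> dfx e0.
have /diff_locallyP[_ /eqaddoP/(_ e e0)] := dfx.
move=> /nbhs_enormP[r r0 H]; exists r => // y yr.
have := H (y - x); rewrite subr0 => /(_ yr) /=.
rewrite !fctE /= subrK opprD addrA differentiable_dotv// => /le_trans; apply.
by rewrite ler_wpM2l ?(ltW e0)// mx_norm_le_enorm.
Qed.

Lemma enorm_eq0 x : enorm x = 0 -> x = 0.
Proof.
move=> x0; apply/rowP => i; rewrite [RHS]mxE; apply/eqP.
by rewrite -normr_le0 -x0 norm_coord_le_enorm.
Qed.

(** Together with the converse [gradient_norm_lt], this makes the two cases in the
    definition of the gradient norm indistinguishable: at a point of
    differentiability the slope is the norm of the gradient, by the increment in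
    the direction of the gradient for this bound and by the Cauchy-Schwarz
    inequality for the other one. *)
Lemma gradient_norm_le f x (c : R) : 0 <= c -> slope_le f x c ->
  (gradient_norm f x <= c%:E)%E.
Proof.
move=> c0 fc; rewrite /gradient_norm; case: asboolP => [dfx|_].
  rewrite lee_fin; set g := gradient f x.
  have [g0|g0] := eqVneq (enorm g) 0; first by rewrite g0.
  have {}g0 : 0 < enorm g by rewrite lt0r g0 enorm_ge0.
  apply/ler_addgt0Pr => e e0.
  have e20 : 0 < e / 2 by rewrite divr_gt0.
  have [r r0 H] := differentiable_taylor dfx e20.
  have [s s0 H'] := fc _ e20.
  pose t := Num.min r s / 2 / enorm g.
  have t0 : 0 < t by rewrite !divr_gt0// lt_min r0.
  have tg : enorm (t *: g) = Num.min r s / 2.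
    by rewrite enormZ gtr0_norm// /t divfK// gt_eqF.
  have tg0 : 0 < enorm (t *: g) by rewrite enormZ mulr_gt0// gtr0_norm.
  have tgr : enorm (t *: g) < r.
    have : Num.min r s <= r by rewrite ge_min lexx.
    by rewrite tg; lra.
  have tgs : enorm (t *: g) < s.
    have : Num.min r s <= s by rewrite ge_min lexx orbT.
    by rewrite tg; lra.
  have := H (x + t *: g); rewrite addrAC subrr add0r => /(_ tgr).
  have := H' (x + t *: g); rewrite addrAC subrr add0r => /(_ tgs).
  rewrite -/g dotvZl -enorm_sqr => /ler_normlP[_ h1] /ler_normlP[h2 _].
  have h3 : t * enorm g ^+ 2 = enorm (t *: g) * enorm g.
    by rewrite enormZ gtr0_norm// expr2 mulrA.
  have : enorm (t *: g) * enorm g <= enorm (t *: g) * (c + e) by lra.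
  by rewrite ler_pM2l.
apply/lee_addgt0Pr => e e0; have [r r0 H] := fc e e0.
apply: ge_ereal_inf.
exists (ereal_sup ((fun y => (`|f x - f y| / enorm (x - y))%:E) @`
    [set y | enorm (y - x) < r])).
  exists [set y | enorm (y - x) < r] => //.
  by apply/nbhs_enormP; exists r => // y yr _.
apply: ge_ereal_sup => _ [y yr <-].
rewrite -EFinD lee_fin.
have [y0|y0] := eqVneq (enorm (x - y)) 0.
  by rewrite y0 invr0 mulr0 addr_ge0// ltW.
rewrite ler_pdivrMr ?lt0r ?y0//=.
by rewrite distrC (enormB x); exact: H.
Qed.

Lemma gradient_norm_lt f x (c : R) : (gradient_norm f x < c%:E)%E ->
  exists2 r, 0 < r & forall y, enorm (y - x) < r ->
    `|f y - f x| <= c * enorm (y - x).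
Proof.
rewrite /gradient_norm; case: asboolP => [dfx|_].
  rewrite lte_fin -subr_gt0 => gc.
  have [r r0 H] := differentiable_taylor dfx gc.
  exists r => // y /H h1.
  have h2 := cauchy_schwarz_dotv (y - x) (gradient f x).
  have := ler_normD (f y - f x - dotv (y - x) (gradient f x)) (dotv (y - x) (gradient f x)).
  by rewrite subrK; lra.
move=> /ereal_inf_lt[_ [V xV <-] Vc].
have /nbhs_enormP[r r0 H] := xV.
exists r => // y yr.
have [->|yx] := eqVneq y x; first by rewrite !subrr normr0 enorm0 mulr0.
have Vy : V y by exact: H.
have yx0 : 0 < enorm (x - y).
  rewrite lt0r enorm_ge0 andbT; apply: contra_neq yx => /enorm_eq0/subr0_eq.
  by move=> ->.
have : ((`|f x - f y| / enorm (x - y))%:E < c%:E)%E.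
  by apply: le_lt_trans Vc; apply: ereal_sup_ubound; exists y.
by rewrite lte_fin ltr_pdivrMr// distrC (enormB x) => /ltW.
Qed.

Hypothesis d0 : (0 < d)%N.

Lemma gradient_norm_ge0 f x : (0 <= gradient_norm f x)%E.
Proof.
rewrite /gradient_norm; case: asboolP => [_|_]; first by rewrite lee_fin.
apply: limf_esup_ge0 => [/nbhs_enormP[r r0 H]|y]; last first.
  by rewrite lee_fin divr_ge0.
pose e0 : 'rV[R]_d := delta_mx 0 (Ordinal d0).
apply: (H (x + (r / 2) *: e0)).
  rewrite addrAC subrr add0r enormZ enorm_delta mulr1 gtr0_norm ?divr_gt0//; lra.
apply/eqP => /rowP/(_ (Ordinal d0)); rewrite !mxE !eqxx mulr1; lra.
Qed.

(** The slope at scale r. Unlike the gradient norm, which is its limit as r tends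
    to 0, it is lower semicontinuous. The point y = x contributes 0, because the
    quotient by 0 is 0. *)
Definition ball_slope f (r : R) x : \bar R :=
  ereal_sup [set (`|f y - f x| / enorm (y - x))%:E | y in [set y | enorm (y - x) < r]].

Lemma ball_slope_ge0 f r x : 0 < r -> (0 <= ball_slope f r x)%E.
Proof.
move=> r0; apply: ereal_sup_ubound; exists x; first by rewrite /= subrr enorm0.
by rewrite !subrr normr0 mul0r.
Qed.

Lemma ball_slope_le f r x c : 0 < r -> 0 <= c ->
  (forall y, enorm (y - x) < r -> `|f y - f x| <= c * enorm (y - x)) ->
  (ball_slope f r x <= c%:E)%E.
Proof.
move=> r0 c0 H; apply: ge_ereal_sup => _ [y yr <-]; rewrite lee_fin.
have [y0|y0] := eqVneq (enorm (y - x)) 0.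
  by rewrite y0 invr0 mulr0.
by rewrite ler_pdivrMr ?lt0r ?y0//=; exact: H.
Qed.

Lemma ball_slope_bound f r x y c : (ball_slope f r x <= c%:E)%E ->
  enorm (y - x) < r -> `|f y - f x| <= c * enorm (y - x).
Proof.
move=> fc yr; have [/enorm_eq0/subr0_eq ->|yx] := eqVneq (enorm (y - x)) 0.
  by rewrite !subrr normr0 enorm0 mulr0.
rewrite -ler_pdivrMr ?lt0r ?yx//= -lee_fin; apply: le_trans fc.
by apply: ereal_sup_ubound; exists y.
Qed.

(** A quotient |f y - f x| / |y - x| exceeding c, for a fixed y, still exceeds c
    when x moves slightly, by continuity of f. *)
Lemma ball_slope_lsc f r : 0 < r -> continuous f -> forall x c, (c%:E < ball_slope f r x)%E ->
  exists2 s, 0 < s & forall y, enorm (y - x) < s -> (c%:E < ball_slope f r y)%E.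
Proof.
move=> r0 cf x c.
have [c0|c0] := ltP c 0.
  move=> _; exists 1 => // y _; apply: lt_le_trans (ball_slope_ge0 _ _ r0).
  by rewrite lte_fin.
move=> /ereal_sup_gt[_ [y yr <-]]; rewrite lte_fin => cq.
have yx0 : 0 < enorm (y - x).
  rewrite lt0r enorm_ge0 andbT; apply: contraTneq cq => ->.
  by rewrite invr0 mulr0 -leNgt.
move: cq; rewrite ltr_pdivlMr// => cq.
pose e := `|f y - f x| - c * enorm (y - x).
have e0 : 0 < e by rewrite subr_gt0.
have [s s0 Hs] : exists2 s, 0 < s & forall z, enorm (z - x) < s -> `|f x - f z| <= e / 2.
  apply/nbhs_enormP; have e20 : 0 < e / 2 by rewrite divr_gt0.
  exact: ((@cvgrPdist_le _ _ _ _ (nbhs_filter x) f (f x)).1 (cf x) _ e20).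
pose t := Num.min s (Num.min (r - enorm (y - x)) (Num.min (enorm (y - x)) (e / 2 / (c + 1)))).
have c1 : 0 < c + 1 by rewrite ltr_wpDl.
exists t; first by rewrite !lt_min s0 subr_gt0 yr yx0 !divr_gt0.
move=> z; rewrite !lt_min => /and4P[zs zr zy ze].
have h1 := ler_distD_enorm x y z; have h2 := ler_distD_enorm z y x.
rewrite (enormB x z) in h1.
apply: (@lt_le_trans _ _ (`|f y - f z| / enorm (y - z))%:E); last first.
  by apply: ereal_sup_ubound; exists y => //=; lra.
rewrite lte_fin ltr_pdivlMr; last by lra.
have h3 := ler_distD (f z) (f y) (f x); have h4 := Hs z zs.
rewrite distrC in h4.
have h5 : c * enorm (y - z) <= c * (enorm (y - x) + enorm (z - x)) by rewrite ler_wpM2l.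
move: ze; rewrite ltr_pdivlMr// => ze.
have := enorm_ge0 (z - x).
rewrite /e in h4 ze *; move: h1 h2 h3 h4 h5 ze; lra.
Qed.

Lemma measurable_ball_slope f r : 0 < r -> continuous f ->
  measurable_fun [set: borelRn R d] (ball_slope f r).
Proof.
move=> r0 cf; apply: (measurability _ (ErealGenOInfty.measurableE R)).
move=> _ [_ [c ->] <-]; rewrite setTI; apply: sub_sigma_algebra.
suff : open [set x : 'rV[R]_d | (ball_slope f r x \in `]c%:E, +oo[)%O] by [].
rewrite openE => x /=; rewrite in_itv/= andbT => cx.
have [s s0 H] := ball_slope_lsc r0 cf cx.
by apply/nbhs_enormP; exists s => // y /H; rewrite /= in_itv/= andbT.
Qed.

Lemma gradient_normE f x :
  gradient_norm f x = ereal_inf (range (fun n => ball_slope f n.+1%:R^-1 x)).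
Proof.
apply/eqP; rewrite eq_le; apply/andP; split.
  apply: le_ereal_inf_tmp => _ [n _ <-].
  have n0 : 0 < n.+1%:R^-1 :> R by rewrite invr_gt0.
  have := ball_slope_ge0 f x n0.
  case E : (ball_slope f n.+1%:R^-1 x) => [b| |] // b0; last by rewrite leey.
  apply: gradient_norm_le => // e e0; exists n.+1%:R^-1 => // y yn.
  apply: ball_slope_bound yn; rewrite E lee_fin lerDl ltW//.
have := gradient_norm_ge0 f x.
case E : (gradient_norm f x) => [G| |] // G0; last by rewrite leey.
apply/lee_addgt0Pr => e e0.
have [r r0 H] : exists2 r, 0 < r & forall y, enorm (y - x) < r ->
    `|f y - f x| <= (G + e) * enorm (y - x).
  by apply: gradient_norm_lt; rewrite E lte_fin ltrDl.
have [n nr] : exists n, n.+1%:R^-1 < r.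
  by have [N _ /(_ N (leqnn N)) ?] := near_infty_natSinv_lt (PosNum r0); exists N.
apply: (@le_trans _ _ (ball_slope f n.+1%:R^-1 x)).
  by apply: ereal_inf_lbound; exists n.
apply: ball_slope_le; rewrite ?invr_gt0 ?addr_ge0 ?(ltW e0)//.
by move=> y yn; apply: H; exact: lt_trans nr.
Qed.

Lemma ball_slope_cvg f x : (fun n => ball_slope f n.+1%:R^-1 x) @ \oo --> gradient_norm f x.
Proof.
rewrite gradient_normE; apply: ereal_nonincreasing_cvgn => m n mn.
apply: ereal_sup_le => _ [y /= yn <-]; exists y => //=.
by apply: lt_le_trans yn _; rewrite lef_pV2 ?posrE// ler_nat.
Qed.

Lemma measurable_gradient_norm f : continuous f ->
  measurable_fun [set: borelRn R d] (gradient_norm f).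
Proof.
move=> cf; apply: (@emeasurable_fun_cvg _ (borelRn R d) R setT (fun n => ball_slope f n.+1%:R^-1)).
  by move=> n; exact: measurable_ball_slope.
by move=> x _; exact: ball_slope_cvg.
Qed.

End gradient_norm_slope.

(** * Means, variances and Fatou's lemma *)

Section mean.
Context {dT : measure_display} {T : measurableType dT} {R : realType}.
Variable P : probability T R.
Implicit Types f g : T -> R.

Definition mean f : R := fine ('E_P[f])%E.

Lemma mean_EFin f : f \in Lfun P 1 -> (\int[P]_x (f x)%:E = (mean f)%:E)%E.
Proof.
by move=> f1; rewrite /mean fineK ?expectation_fin_num// unlock.
Qed.

Lemma Lfun1_cst (c : R) : (fun=> c) \in Lfun P 1.
Proof. exact: Lfun_cst. Qed.

Lemma Lfun1D f g : f \in Lfun P 1 -> g \in Lfun P 1 ->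
  (fun x => f x + g x) \in Lfun P 1.
Proof. by move=> f1 g1; exact: rpredD. Qed.

Lemma Lfun1B f g : f \in Lfun P 1 -> g \in Lfun P 1 ->
  (fun x => f x - g x) \in Lfun P 1.
Proof. by move=> f1 g1; exact: rpredB. Qed.

Lemma Lfun1Z (a : R) f : f \in Lfun P 1 -> (fun x => a * f x) \in Lfun P 1.
Proof.
move=> f1; rewrite (_ : (fun _ => _) = a \o* f); first exact: Lfun_scale.
by apply/funext => x /=; rewrite mulrC.
Qed.

Lemma mean_cst (c : R) : mean (fun=> c) = c.
Proof. by rewrite /mean expectation_cst. Qed.

Lemma meanD f g : f \in Lfun P 1 -> g \in Lfun P 1 ->
  mean (fun x => f x + g x) = mean f + mean g.
Proof.
by move=> f1 g1; rewrite /mean expectationD// fineD// expectation_fin_num.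
Qed.

Lemma meanB f g : f \in Lfun P 1 -> g \in Lfun P 1 ->
  mean (fun x => f x - g x) = mean f - mean g.
Proof.
by move=> f1 g1; rewrite /mean expectationB// fineB// expectation_fin_num.
Qed.

Lemma meanZ (a : R) f : f \in Lfun P 1 -> mean (fun x => a * f x) = a * mean f.
Proof.
move=> f1; rewrite /mean (_ : (fun _ => _) = a \o* f); last first.
  by apply/funext => x /=; rewrite mulrC.
by rewrite expectationZl// fineM// expectation_fin_num.
Qed.

Lemma mean_sum (I : Type) (r : seq I) (F : I -> T -> R) :
  (forall i, F i \in Lfun P 1) ->
  (fun x => \sum_(i <- r) F i x) \in Lfun P 1 /\
  mean (fun x => \sum_(i <- r) F i x) = \sum_(i <- r) mean (F i).
Proof.
move=> F1; elim: r => [|i r [IH1 IH2]].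
  under eq_fun do rewrite big_nil.
  by rewrite big_nil mean_cst; split => //; exact: Lfun1_cst.
under eq_fun do rewrite big_cons.
by rewrite big_cons meanD// IH2; split => //; exact: Lfun1D.
Qed.

Lemma mean_le f g : f \in Lfun P 1 -> g \in Lfun P 1 ->
  (forall x, f x <= g x) -> mean f <= mean g.
Proof.
move=> f1 g1 fg; rewrite -lee_fin -!mean_EFin//; apply: le_integral => //.
- exact/Lfun1_integrable.
- exact/Lfun1_integrable.
- by move=> x _; rewrite lee_fin.
Qed.

Lemma mean_ge0 f : (forall x, 0 <= f x) -> 0 <= mean f.
Proof. by move=> f0; rewrite fine_ge0// expectation_ge0. Qed.

Definition bounded_measurable f :=
  measurable_fun setT f /\ exists M : R, forall x, `|f x| <= M.

Lemma bounded_measurable_Lfun1 f : bounded_measurable f -> f \in Lfun P 1.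
Proof.
move=> [mf [M fM]]; apply/Lfun1_integrable.
apply: measurable_bounded_integrable => //.
  by rewrite [X in (X < _)%E](_ : _ = 1%E) ?ltry//; exact: probability_setT.
exists M; split; first by rewrite num_real.
by move=> N MN x _ /=; rewrite (le_trans (fM x))// ltW.
Qed.

Lemma sqr_Lfun2 f : measurable_fun setT f -> (fun x => f x ^+ 2) \in Lfun P 1 ->
  f \in Lfun P 2%:E.
Proof.
move=> mf /Lfun1_integrable/integrableP[_ f2].
rewrite inE; apply/andP; split; rewrite inE//=.
rewrite /finite_norm unlock poweR_lty//; apply: le_lt_trans f2.
rewrite le_eqVlt; apply/orP; left; apply/eqP; apply: eq_integral => x _ /=.
by rewrite normrX powR_mulrn.
Qed.

Lemma bounded_measurable_Lfun2 f : bounded_measurable f -> f \in Lfun P 2%:E.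
Proof.
move=> [mf [M fM]]; apply: sqr_Lfun2 => //.
apply: bounded_measurable_Lfun1; split; first exact: measurable_funX.
by exists (M ^+ 2) => x; rewrite normrX lerXn2r// ?nnegrE// (le_trans _ (fM x)).
Qed.

Lemma Lfun2_Lfun1 f : f \in Lfun P 2%:E -> f \in Lfun P 1.
Proof. by apply: Lfun_subset12; rewrite fin_num_measure. Qed.

Lemma Lfun2_sqr f : f \in Lfun P 2%:E -> (fun x => f x ^+ 2) \in Lfun P 1.
Proof. by move=> f2; exact: (Lfun2_mul_Lfun1 f2 f2). Qed.

Lemma Lfun2_mul f g : f \in Lfun P 2%:E -> g \in Lfun P 2%:E ->
  (fun x => f x * g x) \in Lfun P 1.
Proof. by move=> f2 g2; exact: (Lfun2_mul_Lfun1 f2 g2). Qed.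

Lemma Lfun2D f g : f \in Lfun P 2%:E -> g \in Lfun P 2%:E ->
  (fun x => f x + g x) \in Lfun P 2%:E.
Proof.
move=> f2 g2; rewrite (_ : (fun _ => _) = f + g)//.
by rewrite rpredD ?lee1n.
Qed.

Lemma Lfun2Z (a : R) f : f \in Lfun P 2%:E -> (fun x => a * f x) \in Lfun P 2%:E.
Proof.
move=> f2; rewrite (_ : (fun _ => _) = a \o* f).
  by apply: Lfun_scale; rewrite // ler1n.
by apply/funext => x /=; rewrite mulrC.
Qed.

Lemma variance_mean f : f \in Lfun P 2%:E ->
  ('V_P[f] = (mean (fun x => f x ^+ 2) - mean f ^+ 2)%:E)%E.
Proof.
move=> f2; rewrite varianceE// EFinB EFin_expe /mean !fineK//.
  by apply: expectation_fin_num; exact: Lfun2_Lfun1.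
by apply: expectation_fin_num; exact: Lfun2_sqr.
Qed.

Lemma Lfun_measurable p f : f \in Lfun P p -> measurable_fun setT f.
Proof. by rewrite inE => /andP[]; rewrite inE. Qed.

Local Open Scope ereal_scope.

(** Twice the variance as a mean square difference of two independent copies. It
    involves no centring, hence makes sense for functions that are not integrable
    and passes to the limit. *)
Definition spread f : \bar R := \int[(P \x P)%E]_z ((f z.1 - f z.2) ^+ 2)%:E.

Lemma measurable_spread f : measurable_fun setT f ->
  measurable_fun setT (fun z : T * T => ((f z.1 - f z.2) ^+ 2)%:E).
Proof.
move=> mf; apply/measurable_EFinP/measurable_funX; apply: measurable_funB.
  exact: measurableT_comp mf measurable_fst.
exact: measurableT_comp mf measurable_snd.
Qed.

Lemma spreadE f : measurable_fun setT f ->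
  spread f = \int[P]_x \int[P]_y ((f x - f y) ^+ 2)%:E.
Proof.
move=> mf; rewrite /spread fubini_tonelli1//; first exact: measurable_spread.
by move=> z; rewrite lee_fin sqr_ge0.
Qed.

Lemma spread_Lfun2 f : f \in Lfun P 2%:E -> spread f = 2%:E * 'V_P[f].
Proof.
move=> f2; rewrite spreadE; last exact: Lfun_measurable f2.
have f1 := Lfun2_Lfun1 f2; have ff := Lfun2_sqr f2.
have c1 (a : R) : (fun=> a) \in Lfun P 1 := Lfun1_cst a.
have af1 (a : R) : (fun y => a * f y)%R \in Lfun P 1 := Lfun1Z a f1.
have inner x : \int[P]_y ((f x - f y) ^+ 2)%:E =
    (f x ^+ 2 - 2 * mean f * f x + mean (fun y => f y ^+ 2))%R%:E.
  have caf1 : (fun y => f x ^+ 2 - 2 * f x * f y)%R \in Lfun P 1.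
    exact: (Lfun1B (c1 _) (af1 _)).
  rewrite (_ : (fun y => _) = (fun y => (f x ^+ 2 - (2 * f x) * f y + f y ^+ 2)%R%:E)); last first.
    by apply/funext => y; congr (_%:E); ring.
  rewrite mean_EFin; last exact: (Lfun1D caf1 ff).
  rewrite meanD// meanB// mean_cst meanZ//.
  by congr (_%:E); ring.
under eq_integral do rewrite inner.
have ffaf1 : (fun x => f x ^+ 2 - 2 * mean f * f x)%R \in Lfun P 1.
  exact: (Lfun1B ff (af1 _)).
rewrite mean_EFin; last exact: (Lfun1D ffaf1 (c1 _)).
rewrite meanD// mean_cst meanB// meanZ//.
by rewrite variance_mean// -EFinM; congr (_%:E); ring.
Qed.

(** By Tonelli's theorem the difference with some constant f x is square
    integrable. *)
Lemma spread_lty_Lfun2 f : measurable_fun setT f -> spread f < +oo ->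
  f \in Lfun P 2%:E.
Proof.
move=> mf; rewrite spreadE// => fy.
have [x xy] : exists x, \int[P]_y ((f x - f y) ^+ 2)%:E < +oo.
  apply: contrapT => /forallNP H; move: fy.
  rewrite (eq_integral (cst +oo)) => [|x _]; last first.
    by apply/eqP; rewrite -leye_eq leNgt; apply/negP/H.
  rewrite integral_cst//= [X in _ * X](_ : _ = 1); last exact: probability_setT.
  by rewrite mule1 ltxx.
have h1 : (fun y => (f x - f y) ^+ 2)%R \in Lfun P 1.
  apply/Lfun1_integrable/integrableP; split.
    by apply/measurable_EFinP/measurable_funX; apply: measurable_funB.
  apply: le_lt_trans xy; rewrite le_eqVlt; apply/orP; left; apply/eqP.
  by apply: eq_integral => y _ /=; rewrite ger0_norm ?sqr_ge0.
have h2 : (fun y => f x - f y)%R \in Lfun P 2%:E.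
  by apply: sqr_Lfun2 => //; exact: measurable_funB.
rewrite (_ : f = (fun y => f x - (f x - f y))%R); last first.
  by apply/funext => y; rewrite subKr.
have h3 : (fun=> f x) \in Lfun P 2%:E by exact: Lfun_cst.
rewrite (_ : (fun _ => _) = (fun=> f x) - (fun y => f x - f y))%R//.
by rewrite rpredB ?lee1n.
Qed.

Lemma variance_spread f : measurable_fun setT f -> 2%:E * 'V_P[f] <= spread f.
Proof.
move=> mf; have [/(spread_lty_Lfun2 mf)/spread_Lfun2 ->//|] := ltP (spread f) +oo.
by rewrite leye_eq => /eqP ->; rewrite leey.
Qed.

Lemma variance_lty_Lfun2 f : measurable_fun setT f ->
  'V_P[f] < +oo -> f \in Lfun P 2%:E.
Proof.
move=> mf Vf; set c := fine ('E_P[f]).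
have mfc : measurable_fun setT (fun x => f x - c)%R.
  exact: (measurable_funB mf (measurable_cst _)).
have h1 : (fun x => f x - c)%R \in Lfun P 2%:E.
  apply: sqr_Lfun2; first exact: mfc.
  apply/Lfun1_integrable/integrableP; split.
    by apply/measurable_EFinP/measurable_funX; exact: mfc.
  apply: le_lt_trans Vf; rewrite /variance unlock [in leRHS]unlock.
  rewrite le_eqVlt; apply/orP; left; apply/eqP; apply: eq_integral => x _ /=.
  by rewrite ger0_norm ?sqr_ge0// expr2 /c unlock.
have h2 : (fun=> c) \in Lfun P 2%:E by exact: Lfun_cst.
rewrite (_ : f = (fun x => f x - c + c)%R); first exact: (Lfun2D h1 h2).
by apply/funext => x; rewrite subrK.
Qed.

(** Fatou's lemma for the spread. Only the differences need to converge, so that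
    additive constants, such as those of the truncations, do not matter. *)
Lemma variance_fatou (u : nat -> T -> R) f (b : nat -> \bar R) (B : \bar R) :
  measurable_fun setT f -> (forall n, bounded_measurable (u n)) ->
  (forall x y, (u n x - u n y)%R @[n --> \oo] --> (f x - f y)%R) ->
  (forall n, 'V_P[u n] <= b n) -> b n @[n --> \oo] --> B -> 'V_P[f] <= B.
Proof.
move=> mf bu ucvg ub bB.
have mu n : measurable_fun setT (u n) by case: (bu n).
suff : 2%:E * 'V_P[f] <= 2%:E * B by rewrite lee_pmul2l.
apply: le_trans (variance_spread mf) _.
have -> : spread f = \int[(P \x P)%E]_z
    limn_einf (fun n => ((u n z.1 - u n z.2) ^+ 2)%:E).
  apply: eq_integral => z _; apply/esym.
  apply: (@cvg_limn_einf_sup R _ _ _).1.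
  apply: cvg_EFin; first by near=> n.
  under eq_fun do rewrite /= expr2; rewrite expr2.
  by apply: cvgM; exact: ucvg.
apply: le_trans (fatou _ _ _ _) _ => //.
- by move=> n; exact: measurable_spread.
- by move=> n z _; rewrite lee_fin sqr_ge0.
have -> : 2%:E * B = limn_einf (fun n => 2%:E * b n).
  apply/esym; apply: (@cvg_limn_einf_sup R _ _ _).1.
  by apply: cvgeZl.
rewrite !limn_einf_lim; apply: lee_lim; [exact: is_cvg_einfs|exact: is_cvg_einfs|].
apply: nearW => n; apply: le_ereal_inf_tmp => _ [m /= nm <-].
apply: (@le_trans _ _ (spread (u m))).
  by apply: ereal_inf_lbound; exists m.
rewrite spread_Lfun2; last exact: bounded_measurable_Lfun2.
by rewrite lee_pmul2l.
Unshelve. all: by end_near. Qed.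

End mean.

(** * From smooth functions to locally Lipschitz functions *)

Section smooth_functions_suffice.
Context {R : realType} {d : nat}.
Implicit Types (x y z h : 'rV[R]_d) (f u w : 'rV[R]_d -> R).
Implicit Types (g : 'rV[R]_d -> 'rV[R]_d).

Lemma elip_locally_lipschitz (L : R) f : elip L f -> locally_lipschitz f.
Proof.
move=> fL x; exists setT; first exact: filterT.
exists (`|L| * d%:R); split; first by rewrite num_real.
move=> M /ltW LM [y z] _ /=; apply: le_trans (fL y z) _.
apply: (@le_trans _ _ (`|L| * d%:R * `|y - z|)); last by rewrite ler_wpM2r.
rewrite -mulrA.
apply: (@le_trans _ _ (`|L| * enorm (y - z))).
  by rewrite ler_wpM2r// ler_norm.
by rewrite ler_wpM2l// enorm_le_mx_norm.
Qed.

Lemma elip_measurable (L : R) f : elip L f ->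
  measurable_fun [set: borelRn R d] f.
Proof. by move=> /elip_continuous; exact: continuous_borel_measurable. Qed.

Lemma C11_bounded_measurable w g : C11 w g ->
  @bounded_measurable _ (borelRn R d) R w.
Proof. by move=> [wM [l [_ wl _ _]]]; split => //; exact: elip_measurable wl. Qed.

Lemma elip_field_measurable (l : R) g : elip_field l g ->
  measurable_fun [set: borelRn R d] (fun x => enorm (g x) ^+ 2).
Proof.
move=> gl; under eq_fun do rewrite enorm_sqr.
apply: measurable_sum => i; apply: measurable_funM; exact: elip_measurable (gl i).
Qed.

Lemma gradient_norm_slope_le f x (c : R) : (gradient_norm f x <= c%:E)%E ->
  slope_le f x c.
Proof.
move=> fc e e0; apply: gradient_norm_lt; apply: le_lt_trans fc _.
by rewrite lte_fin ltrDl.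
Qed.

Hypothesis d0 : (0 < d)%N.
Variables (m : probability (borelRn R d) R) (K : R).
Hypothesis K0 : 0 < K.
Hypothesis smoothP : forall w g, C11 w g ->
  ('V_m[w] <= K%:E * \int[m]_x (enorm (g x) ^+ 2)%:E)%E.

Let nv (n : nat) : R := n.+1%:R^-1.

Let nv0 n : 0 < nv n.
Proof. by rewrite invr_gt0. Qed.

Let nv1 n : nv n <= 1.
Proof. by rewrite invf_le1// ler1n. Qed.

Lemma smooth_sequence (M S rho : R) f n : 0 <= S -> (forall x, 0 <= f x <= M) ->
  (forall x, rho < enorm x -> f x = 0) -> elip S f ->
  exists w g, [/\ C11 w g, forall x, `|w x - f x| <= 2 * nv n &
    forall x, enorm (g x) <= fine (ball_slope f (nv n) x) + 2 * nv n].
Proof.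
move=> S0 fM frho fS; have fc := elip_continuous fS.
have bS x : (ball_slope f (nv n) x <= S%:E)%E.
  by apply: ball_slope_le => // y _; exact: fS.
have b0 x : (0 <= ball_slope f (nv n) x)%E by exact: ball_slope_ge0.
have bE x : ball_slope f (nv n) x = (fine (ball_slope f (nv n) x))%:E.
  by rewrite fineK// ge0_fin_numE// (le_lt_trans (bS x)) ?ltry.
pose b x := fine (ball_slope f (nv n) x).
have bS' x : 0 <= b x <= S by rewrite -!lee_fin -bE b0 bS.
(* The margin nv n makes h strictly larger than the slope of f. *)
pose h x := b x + nv n.
have [||||||u [uf [k [l [kl uk]]]] uD] :=
    @relaxation R d f h _ _ _ _ M rho (nv n) (nv0 n).
- by move=> x; have /andP[? ?] := bS' x; rewrite addr_ge0// ltW.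
- move=> x c cx.
  have [|s s0 Hs] := @ball_slope_lsc R d f (nv n) (nv0 n) fc x (c - nv n).
    by rewrite (bE x) lte_fin ltrBlDr.
  exists s; first exact: s0.
  by move=> y /Hs; rewrite (bE y) lte_fin ltrBlDr.
- move=> x; exists (b x); first by have /andP[-> _] := bS' x; rewrite /h ltrDl nv0.
  exists (nv n) => // y yx; apply: ball_slope_bound yx; by rewrite bE.
- by move=> x; have /andP[] := fM x.
- by move=> x; have /andP[] := fM x.
- exact: frho.
have kl' : elip `|l| k.
  by move=> x y; apply: le_trans (kl x y) _; rewrite ler_wpM2r// ler_norm.
have S1 : 0 <= S + 1 by rewrite addr_ge0.
have kS x : 0 <= k x <= S + 1.
  have [/andP[-> kh] _] := uk x; apply: le_trans kh _.
  by have /andP[_ ?] := bS' x; rewrite lerD.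
have uM x : `|u x| <= M.
  have /andP[u0 u1] := uf x; rewrite ger0_norm// (le_trans u1)//.
  by have /andP[] := fM x.
have [w [g [wg wu gk]]] := smooth_approximation (nv0 n) (normr_ge0 l) S1 uM kl' kS
  (fun x => (uk x).2).
exists w, g; split => // x.
  rewrite (le_trans (ler_distD (u x) _ _))// mulr_natl mulr2n lerD//.
  have /andP[_ u1] := uf x; rewrite distrC ger0_norm ?subr_ge0//.
  by have := uD x; lra.
apply: le_trans (gk x) _; have [/andP[_ kh] _] := uk x.
by rewrite mulr_natl mulr2n addrA lerD2r.
Qed.

(** The slopes at scale 1 / (n + 1) decrease to the gradient norm and are bounded
    by the Lipschitz constant S, so that dominated convergence applies to the
    right-hand side, while the variance is lower semicontinuous. *)
Lemma poincare_compact_support (M S rho : R) f : 0 <= S ->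
  (forall x, 0 <= f x <= M) ->
  (forall x, rho < enorm x -> f x = 0) -> elip S f ->
  ('V_m[f] <= K%:E * \int[m]_x (gradient_norm f x) ^+ 2)%E.
Proof.
move=> S0 fM frho fS; have fc := elip_continuous fS.
have /choice[w /choice[g wg]] : forall n, exists w, exists g,
    [/\ C11 w g, forall x, `|w x - f x| <= 2 * nv n &
    forall x, enorm (g x) <= fine (ball_slope f (nv n) x) + 2 * nv n].
  by move=> n; exact: smooth_sequence fM frho fS.
pose b n x := fine (ball_slope f (nv n) x).
have bS n x : (ball_slope f (nv n) x <= S%:E)%E.
  by apply: ball_slope_le => // y _; exact: fS.
have b0 n x : (0 <= ball_slope f (nv n) x)%E by exact: ball_slope_ge0.
have bE n x : ball_slope f (nv n) x = (b n x)%:E.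
  by rewrite fineK// ge0_fin_numE// (le_lt_trans (bS n x)) ?ltry.
have bS' n x : 0 <= b n x <= S by rewrite -!lee_fin -bE b0 bS.
have mb n : measurable_fun [set: borelRn R d] (b n).
  apply/measurable_EFinP; rewrite (_ : EFin \o b n = ball_slope f (nv n)).
    exact: measurable_ball_slope.
  by apply/funext => x; rewrite [RHS]bE.
have nvcvg : nv n @[n --> \oo] --> (0 : R) by exact: cvg_harmonic.
have nv2cvg : 2 * nv n @[n --> \oo] --> (0 : R).
  by rewrite -(mulr0 2); apply: cvgM; [exact: cvg_cst|exact: nvcvg].
pose F n x : \bar R := ((b n x + 2 * nv n) ^+ 2)%:E.
have mF n : measurable_fun [set: borelRn R d] (F n).
  by apply/measurable_EFinP/measurable_funX; apply: measurable_funD.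
apply: (@variance_fatou _ _ _ m w f (fun n => K%:E * \int[m]_x F n x)%E).
- exact: continuous_borel_measurable.
- by move=> n; have [wn _ _] := wg n; exact: C11_bounded_measurable wn.
- have wf x : w n x @[n --> \oo] --> f x.
    have cl : f x - 2 * nv n @[n --> \oo] --> f x.
      rewrite -[X in _ --> X]subr0.
      by apply: cvgB; [exact: cvg_cst|exact: nv2cvg].
    have cr : f x + 2 * nv n @[n --> \oo] --> f x.
      rewrite -[X in _ --> X]addr0.
      by apply: cvgD; [exact: cvg_cst|exact: nv2cvg].
    apply: (squeeze_cvgr _ cl cr); apply: nearW => n.
    by have [_ /(_ x) + _] := wg n; rewrite ler_distl.
  by move=> x y; apply: cvgB; exact: wf.
- move=> n; have [wn _ gn] := wg n; apply: le_trans (smoothP wn) _.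
  rewrite lee_pmul2l// ?lte_fin//; apply: ge0_le_integral => //.
  + by move=> x _; rewrite lee_fin sqr_ge0.
  + apply/measurable_EFinP; have [_ [l [_ _ gl _]]] := wn.
    exact: elip_field_measurable gl.
  + by move=> x _; rewrite lee_fin lerXn2r ?nnegrE// (le_trans _ (gn x)).
- apply: cvgeZl => //.
  have Gfin x : gradient_norm f x \is a fin_num.
    rewrite ge0_fin_numE ?gradient_norm_ge0//.
    rewrite (@le_lt_trans _ _ S%:E) ?ltry//; apply: gradient_norm_le => //.
    exact: elip_slope.
  have GE x : gradient_norm f x = (fine (gradient_norm f x))%:E.
    by rewrite fineK.
  have Fcvg x : F n x @[n --> \oo] --> (gradient_norm f x ^+ 2)%E.
    rewrite GE -EFin_expe; apply: cvg_EFin; first exact: nearW.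
    rewrite /F; under eq_fun do rewrite /= expr2.
    have bc : b n x + 2 * nv n @[n --> \oo] --> fine (gradient_norm f x).
      rewrite -[X in _ --> X]addr0.
      apply: cvgD; last exact: nv2cvg.
      by apply: fine_cvg; rewrite -GE; exact: ball_slope_cvg.
    by rewrite expr2; apply: cvgM.
  have [] := @dominated_convergence _ (borelRn R d) R m setT measurableT F
    (fun x => (gradient_norm f x) ^+ 2)%E (fun=> ((S + 2) ^+ 2)%:E) mF.
  + by apply: (@emeasurable_fun_cvg _ (borelRn R d) R setT F) => // x _; exact: Fcvg.
  + by apply: aeW => x _; exact: Fcvg.
  + exact: finite_measure_integrable_cst.
  + apply: aeW => x n _; rewrite /F gee0_abs ?lee_fin ?sqr_ge0//.
    have /andP[bn0 bnS] := bS' n x.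
    have h0 : 0 <= b n x + 2 * nv n by have := nv0 n; lra.
    have h1 : b n x + 2 * nv n <= S + 2 by have := nv1 n; lra.
    by apply: lerXn2r => //; rewrite nnegrE (le_trans h0).
  + by move=> _ _.
Qed.

End smooth_functions_suffice.

Section localization.
Context {R : realType} {d : nat}.
Implicit Types (x y z h : 'rV[R]_d) (f u w : 'rV[R]_d -> R).

Lemma locally_lipschitz_local_elip f x : locally_lipschitz f ->
  exists2 r, 0 < r & exists2 M, 0 <= M & forall y z, enorm (y - x) < r ->
    enorm (z - x) < r -> `|f y - f z| <= M * enorm (y - z).
Proof.
move=> /(_ x)[U /nbhs_enormP[r r0 rU]] /pinfty_ex_gt0[M M0 MU].
exists r => //; exists M; first exact: ltW.
move=> y z /rU Uy /rU Uz; apply: le_trans (MU (y, z) (conj Uy Uz)) _ => /=.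
by rewrite ler_wpM2l ?(ltW M0)// mx_norm_le_enorm.
Qed.

Lemma locally_lipschitz_continuous f : locally_lipschitz f -> continuous f.
Proof.
move=> fl x; have [r r0 [M M0 H]] := locally_lipschitz_local_elip x fl.
apply/(@cvgrPdist_le _ _ _ _ (nbhs_filter x)) => e e0.
have M1 : 0 < M + 1 by rewrite ltr_wpDl.
apply/nbhs_enormP; exists (Num.min r (e / (M + 1))).
  by rewrite lt_min r0 divr_gt0.
move=> y; rewrite lt_min => /andP[yr]; rewrite ltr_pdivlMr// => ye.
have := H x y; rewrite subrr enorm0 => /(_ r0 yr)/le_trans; apply.
by rewrite enormB; have := enorm_ge0 (y - x); lra.
Qed.

(** Equal to 1 on the ball of radius p ^ 2 and to 0 outside the ball of radius
    2 * p ^ 2, so that its slope p ^- 2 is small compared with the size p of the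
    truncated function. *)
Definition cutoff (p : R) x : R := Num.max 0 (Num.min 1 (2 - enorm x / p ^+ 2)).

(** The constant p is added to make the truncation nonnegative. It is immaterial
    for variances and disappears in the differences of two values. *)
Definition truncation (p : R) f x : R :=
  cutoff p x * (Num.max (- p) (Num.min p (f x)) + p).

Variable p : R.
Hypothesis p0 : 0 < p.

Lemma cutoff01 x : 0 <= cutoff p x <= 1.
Proof. by rewrite /cutoff le_max lexx ge_max ler01 ge_min lexx. Qed.

Lemma elip_cutoff : elip (p ^- 2) (cutoff p).
Proof.
move=> x y; have pp : 0 < p ^+ 2 by rewrite exprn_gt0.
apply: (@le_trans _ _ `|enorm x / p ^+ 2 - enorm y / p ^+ 2|).
  apply: le_trans (ler_dist_max _ _ _) _; apply: le_trans (ler_dist_min _ _ _) _.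
  by rewrite opprD addrACA subrr add0r -opprD normrN.
rewrite -mulrBl normrM (@gtr0_norm _ (p ^- 2)) ?invr_gt0// mulrC.
apply: ler_wpM2l; first by rewrite invr_ge0 ltW.
have h1 := ler_distD_enorm y x 0; have h2 := ler_distD_enorm x y 0.
rewrite !subr0 in h1 h2; rewrite (enormB y) in h2.
by rewrite ler_norml; apply/andP; split; lra.
Qed.

Lemma clamp_le (a b : R) :
  `|Num.max (- p) (Num.min p a) - Num.max (- p) (Num.min p b)| <= `|a - b|.
Proof.
exact: le_trans (ler_dist_max _ _ _) (ler_dist_min _ _ _).
Qed.

Lemma clamp_bound (a : R) : 0 <= Num.max (- p) (Num.min p a) + p <= 2 * p.
Proof.
rewrite -lerBlDr sub0r le_max lexx /= mulr_natl mulr2n lerD2r ge_max ge_min lexx.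
by rewrite andbT lerNl ltW// (lt_trans _ p0)// oppr_lt0.
Qed.

Lemma truncation_bound f x : 0 <= truncation p f x <= 2 * p.
Proof.
have /andP[c0 c1] := cutoff01 x; have /andP[t0 t1] := clamp_bound (f x).
rewrite /truncation mulr_ge0//= -[leRHS]mul1r ler_pM//.
Qed.

Lemma truncation_support f x : 2 * p ^+ 2 < enorm x -> truncation p f x = 0.
Proof.
move=> px; rewrite /truncation /cutoff max_l ?mul0r//.
rewrite ge_min; apply/orP; right; rewrite subr_le0 ler_pdivlMr ?exprn_gt0//.
exact: ltW.
Qed.

Lemma truncation_id f x : `|f x| <= p -> enorm x <= p ^+ 2 ->
  truncation p f x = f x + p.
Proof.
rewrite ler_norml => /andP[f1 f2] xp.
have : enorm x / p ^+ 2 <= 1 by rewrite ler_pdivrMr ?exprn_gt0// mul1r.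
move=> xp1; rewrite /truncation (_ : cutoff p x = 1) ?mul1r.
  by rewrite (min_r f2) max_r.
by rewrite /cutoff min_l ?max_r//; lra.
Qed.

(** The product rule: the truncated values are at most 2 * p, against a slope
    p ^- 2 of the cutoff. *)
Lemma slope_truncation f x c : slope_le f x c ->
  slope_le (truncation p f) x (c + 2 / p).
Proof.
move=> fc e e0; have [r r0 H] := fc _ e0; exists r => // y yr.
pose F z := Num.max (- p) (Num.min p (f z)) + p.
rewrite /truncation -/(F x) -/(F y).
rewrite (_ : _ - _ = cutoff p y * (F y - F x) + (cutoff p y - cutoff p x) * F x); last by ring.
have FyFx : `|F y - F x| <= (c + e) * enorm (y - x).
  rewrite /F opprD addrACA subrr addr0; exact: le_trans (clamp_le _ _) (H y yr).
have /andP[c0 c1] := cutoff01 y; have /andP[t0 t1] := clamp_bound (f x).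
have h1 : `|cutoff p y * (F y - F x)| <= (c + e) * enorm (y - x).
  rewrite normrM (ger0_norm c0) (le_trans _ FyFx)// ler_piMl//.
have h2 : `|(cutoff p y - cutoff p x) * F x| <= 2 / p * enorm (y - x).
  rewrite normrM (ger0_norm t0).
  apply: (@le_trans _ _ (p ^- 2 * enorm (y - x) * (2 * p))).
    by rewrite ler_pM// elip_cutoff.
  rewrite le_eqVlt; apply/orP; left; apply/eqP; field.
  by rewrite gt_eqF.
by apply: le_trans (ler_normD _ _) _; lra.
Qed.

(** A local Lipschitz constant bounds the slope near each point of the support;
    compactness makes the bound uniform, and the slope vanishes outside. *)
Lemma truncation_elip f : locally_lipschitz f ->
  exists2 S, 0 <= S & elip S (truncation p f).
Proof.
move=> fl; pose P (A : set 'rV[R]_d) :=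
  exists2 S, 0 <= S & forall x, A x -> slope_le (truncation p f) x S.
have [S S0 H] : P [set x | enorm x <= 2 * p ^+ 2].
  apply: compact_local_to_global.
  - exact: compact_enorm_ball.
  - by exists 0.
  - move=> A B [S1 S10 H1] [S2 S20 H2]; exists (Num.max S1 S2).
      by rewrite le_max S10.
    move=> x [/H1|/H2]; apply: slope_leW; by rewrite le_max lexx ?orbT.
  - by move=> A B AB [S S0 H]; exists S => // x /AB/H.
  - move=> x _; have [r r0 [M M0 H]] := locally_lipschitz_local_elip x fl.
    exists [set y | enorm (y - x) < r]; first by apply/nbhs_enormP; exists r.
    exists (M + 2 / p); first by rewrite addr_ge0// divr_ge0// ltW.
    move=> y /= yr; apply: slope_truncation => e e0.
    exists (r - enorm (y - x)); first by rewrite subr_gt0.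
    move=> z zy; apply: le_trans (H _ _ _ yr) _.
      by have := ler_distD_enorm y z x; lra.
    by rewrite ler_wpM2r// lerDl ltW.
exists S => // x y; apply: slope_le_segment => t _.
set z := y + _; have [/H//|zp] := leP (enorm z) (2 * p ^+ 2).
move=> e e0; exists (enorm z - 2 * p ^+ 2); first by rewrite subr_gt0.
move=> v vz; rewrite !truncation_support//.
  by rewrite subrr normr0 mulr_ge0// addr_ge0// ltW.
by have := ler_distD_enorm v z 0; rewrite !subr0 enormB; lra.
Qed.

End localization.

Section smooth_functions_suffice.
Local Open Scope ereal_scope.
Context {R : realType} {d : nat}.
Hypothesis d0 : (0 < d)%N.
Variables (m : probability (borelRn R d) R) (K : R).
Hypothesis K0 : (0 < K)%R.
Hypothesis smoothP : forall w g, C11 w g ->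
  'V_m[w] <= K%:E * \int[m]_x (enorm (g x) ^+ 2)%:E.

Lemma sqre_ge0 (x : \bar R) : 0 <= x -> 0 <= x ^+ 2.
Proof. by move=> x0; rewrite expe2 mule_ge0. Qed.

(** If the gradient norm is square integrable, the truncations of f satisfy the
    inequality with slope bound G + t, and (G + t)^2 <= (1 + t) G^2 + t + t^2.
    Otherwise the right-hand side is infinite, because K is positive. *)
Theorem poincare_of_smooth : poincare_inequality m K.
Proof.
move=> f fl; have fc := locally_lipschitz_continuous fl.
have G0 x : 0 <= gradient_norm f x by exact: gradient_norm_ge0.
have mG : measurable_fun [set: borelRn R d] (gradient_norm f).
  exact: measurable_gradient_norm.
have mG2 : measurable_fun [set: borelRn R d] (fun x => gradient_norm f x ^+ 2).
  by under eq_fun do rewrite expe2; exact: emeasurable_funM.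
have I0 : 0 <= \int[m]_x gradient_norm f x ^+ 2.
  by apply: integral_ge0 => x _; exact: sqre_ge0.
case IE : (\int[m]_x gradient_norm f x ^+ 2) I0 => [I| |] // I0; last first.
  by rewrite gt0_muley ?lte_fin// leey.
pose p n : R := n.+1%:R.
have p0 n : (0 < p n)%R by [].
pose t n : R := (2 / p n)%R.
have t0 n : (0 <= t n)%R by rewrite divr_ge0.
pose F n := truncation (p n) f.
have FV n : 'V_m[F n] <= (K * ((1 + t n) * I + (t n + t n ^+ 2)))%:E.
  have [S S0 FS] := truncation_elip (p0 n) fl.
  apply: le_trans (poincare_compact_support d0 K0 smoothP S0
    (truncation_bound (p0 n) f) (@truncation_support R d (p n) (p0 n) f) FS) _.
  rewrite EFinM lee_pmul2l ?lte_fin//.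
  rewrite EFinD EFinM -IE -ge0_integralZl//; last 2 first.
  - by move=> x _; exact: sqre_ge0.
  - by rewrite lee_fin addr_ge0.
  have -> : (t n + t n ^+ 2)%:E = \int[m]_x (t n + t n ^+ 2)%:E.
    rewrite integral_cst//= [X in _ * X](_ : _ = 1) ?mule1//.
    exact: probability_setT.
  rewrite -ge0_integralD//; last 3 first.
  - by move=> x _; rewrite mule_ge0 ?sqre_ge0// lee_fin addr_ge0.
  - by apply: measurable_funeM.
  - by move=> x _; rewrite lee_fin addr_ge0// sqr_ge0.
  have mF : measurable_fun [set: borelRn R d] (gradient_norm (F n)).
    by apply: measurable_gradient_norm => //; exact: elip_continuous FS.
  have F0 x : 0 <= gradient_norm (F n) x by exact: gradient_norm_ge0.
  apply: ge0_le_integral => //.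
  - by move=> x _; exact: sqre_ge0.
  - by under eq_fun do rewrite expe2; exact: emeasurable_funM.
  - by apply: emeasurable_funD => //; apply: measurable_funeM.
  - move=> x _; case E : (gradient_norm f x) (G0 x) => [g| |] // g0; last first.
      have -> : (+oo : \bar R) ^+ 2 = +oo by rewrite expe2 mulyy.
      by rewrite gt0_muley ?lte_fin ?ltr_pwDl// addye ?leey.
    have : gradient_norm (F n) x <= (g + t n)%:E.
      apply: gradient_norm_le; first by rewrite addr_ge0.
      by apply: slope_truncation => //; apply: gradient_norm_slope_le; rewrite E.
    case E' : (gradient_norm (F n) x) (F0 x) => [h| |] //.
    rewrite !lee_fin => h0 hg; rewrite lee_fin in g0.
    apply: (@le_trans _ _ ((g + t n) * (g + t n))%R); first exact: ler_pM.
    by have := mulr_ge0 (t0 n) (sqr_ge0 (g - 1)); lra.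
have ncvg : (n.+1%:R^-1 : R)%R @[n --> \oo] --> (0 : R)%R by exact: cvg_harmonic.
have tcvg : t n @[n --> \oo] --> (0 : R)%R.
  by rewrite -(mulr0 2%R); apply: cvgM; [exact: cvg_cst|exact: ncvg].
apply: (@variance_fatou _ _ _ m F f _ _ _ _ _ FV).
- exact: continuous_borel_measurable.
- move=> n; have [S _ FS] := truncation_elip (p0 n) fl.
  split; first exact: elip_measurable FS.
  exists (2 * p n)%R => x; have /andP[F0 F1] := truncation_bound (p0 n) f x.
  by rewrite ger0_norm.
- move=> x y; apply: cvg_near_cst.
  have ev z : \forall n \near \oo, F n z = (f z + p n)%R.
    near=> n.
    have np : (n%:R <= p n)%R by rewrite ler_nat.
    have p1 : (1 <= p n)%R by rewrite ler1n.
    apply: truncation_id => //.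
      by apply: le_trans np; near: n; exact: nbhs_infty_ger.
    apply: (@le_trans _ _ (p n)); last by rewrite expr2 ler_peMr// (le_trans _ p1).
    by apply: le_trans np; near: n; exact: nbhs_infty_ger.
  near=> n; rewrite (near (ev x) n)// (near (ev y) n)//; ring.
- apply: cvg_EFin; first exact: nearW.
  rewrite /= -[X in _ --> (K * X)%R](_ : (1 + 0) * I + (0 + 0 ^+ 2) = I)%R; last by ring.
  apply: cvgM; first exact: cvg_cst.
  apply: cvgD.
    apply: cvgM; last exact: cvg_cst.
    by apply: cvgD; [exact: cvg_cst|exact: tcvg].
  apply: cvgD; first exact: tcvg.
  rewrite expr2; under eq_fun do rewrite expr2; exact: cvgM.
Unshelve. all: by end_near. Qed.

End smooth_functions_suffice.

(** * Bounded functions of two independent variables *)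

Section bounded_measurable_algebra.
Context {dT : measure_display} {T : measurableType dT} {R : realType}.
Implicit Types f g : T -> R.

Lemma bm_cst (c : R) : bounded_measurable ((fun=> c) : T -> R).
Proof. by split => //; exists `|c|. Qed.

Lemma bmD f g : bounded_measurable f -> bounded_measurable g ->
  bounded_measurable (fun x => f x + g x).
Proof.
move=> [mf [M fM]] [mg [N gN]]; split; first exact: measurable_funD.
by exists (M + N) => x; rewrite (le_trans (ler_normD _ _))// lerD.
Qed.

Lemma bmM f g : bounded_measurable f -> bounded_measurable g ->
  bounded_measurable (fun x => f x * g x).
Proof.
move=> [mf [M fM]] [mg [N gN]]; split; first exact: measurable_funM.
by exists (M * N) => x; rewrite normrM ler_pM.
Qed.

Lemma bmZ (a : R) f : bounded_measurable f -> bounded_measurable (fun x => a * f x).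
Proof. by move=> bf; apply: bmM => //; exact: bm_cst. Qed.

Lemma bmB f g : bounded_measurable f -> bounded_measurable g ->
  bounded_measurable (fun x => f x - g x).
Proof.
move=> bf bg; apply: bmD => //; under eq_fun do rewrite -mulN1r; exact: bmZ.
Qed.

Lemma bmX f n : bounded_measurable f -> bounded_measurable (fun x => f x ^+ n).
Proof.
move=> bf; elim: n => [|n IH]; first exact: bm_cst.
by under eq_fun do rewrite exprS; exact: bmM.
Qed.

Lemma bm_sum (I : Type) (r : seq I) (F : I -> T -> R) :
  (forall i, bounded_measurable (F i)) ->
  bounded_measurable (fun x => \sum_(i <- r) F i x).
Proof.
move=> bF; elim: r => [|i r IH].
  by under eq_fun do rewrite big_nil; exact: bm_cst.
by under eq_fun do rewrite big_cons; exact: bmD.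
Qed.

End bounded_measurable_algebra.

Section fubini_mean.
Context {d1 d2 : measure_display} {T1 : measurableType d1} {T2 : measurableType d2}.
Context {R : realType} (P : probability T1 R) (Q : probability T2 R).
Implicit Type F : T1 * T2 -> R.

Lemma bm_comp {dT dU : measure_display} {T : measurableType dT} {U : measurableType dU}
  (f : U -> R) (h : T -> U) : measurable_fun setT h -> bounded_measurable f ->
  bounded_measurable (f \o h).
Proof.
move=> mh [mf [M fM]]; split; first exact: measurableT_comp.
by exists M => x; exact: fM.
Qed.

Lemma mean_bound {dT : measure_display} {T : measurableType dT} (S : probability T R)
  (f : T -> R) (M : R) : bounded_measurable f -> (forall x, `|f x| <= M) ->
  `|mean S f| <= M.
Proof.
move=> bf fM; have f1 := bounded_measurable_Lfun1 S bf.
rewrite ler_norml; apply/andP; split.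
  rewrite -[leLHS](mean_cst S); apply: mean_le => //; first exact: Lfun1_cst.
  by move=> x; have := fM x; rewrite ler_norml => /andP[].
rewrite -[leRHS](mean_cst S); apply: mean_le => //; first exact: Lfun1_cst.
by move=> x; have := fM x; rewrite ler_norml => /andP[].
Qed.

Lemma bm_pair1 F x : bounded_measurable F -> bounded_measurable (fun y => F (x, y)).
Proof. by move=> bF; apply: (bm_comp _ bF); exact: pair1_measurable. Qed.

Lemma bm_pair2 F y : bounded_measurable F -> bounded_measurable (fun x => F (x, y)).
Proof. by move=> bF; apply: (bm_comp _ bF); exact: pair2_measurable. Qed.

Lemma fubini_mean1 F : bounded_measurable F ->
  bounded_measurable (fun x => mean Q (fun y => F (x, y))) /\
  mean (P \x Q)%E F = mean P (fun x => mean Q (fun y => F (x, y))).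
Proof.
move=> bF; have F1 := bounded_measurable_Lfun1 (P \x Q)%E bF.
have Fi := (Lfun1_integrable _ _).1 F1.
have bm : bounded_measurable (fun x => mean Q (fun y => F (x, y))).
  split.
    have -> : (fun x => mean Q (fun y => F (x, y))) =
        fine \o (fun x => \int[Q]_y (F (x, y))%:E)%E.
      by apply/funext => x; rewrite /mean unlock.
    apply: measurableT_comp; first exact: fine_measurable.
    exact: measurable_fubini_F Fi.
  have [_ [M FM]] := bF; exists M => x; apply: mean_bound => //.
  exact: bm_pair1.
split => //; apply: EFin_inj; rewrite -!mean_EFin//; last exact: bounded_measurable_Lfun1.
rewrite -integral12_prod_meas1//; apply: eq_integral => x _.
by rewrite /fubini_F mean_EFin//; apply: bounded_measurable_Lfun1; exact: bm_pair1.
Qed.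

Lemma fubini_mean2 F : bounded_measurable F ->
  bounded_measurable (fun y => mean P (fun x => F (x, y))) /\
  mean (P \x Q)%E F = mean Q (fun y => mean P (fun x => F (x, y))).
Proof.
move=> bF; have F1 := bounded_measurable_Lfun1 (P \x Q)%E bF.
have Fi := (Lfun1_integrable _ _).1 F1.
have bm : bounded_measurable (fun y => mean P (fun x => F (x, y))).
  split.
    have -> : (fun y => mean P (fun x => F (x, y))) =
        fine \o (fun y => \int[P]_x (F (x, y))%:E)%E.
      by apply/funext => x; rewrite /mean unlock.
    apply: measurableT_comp; first exact: fine_measurable.
    exact: measurable_fubini_G Fi.
  have [_ [M FM]] := bF; exists M => x; apply: mean_bound => //.
  exact: bm_pair2.
split => //; apply: EFin_inj; rewrite -!mean_EFin//; last exact: bounded_measurable_Lfun1.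
rewrite -integral21_prod_meas1//; apply: eq_integral => x _.
by rewrite /fubini_G mean_EFin//; apply: bounded_measurable_Lfun1; exact: bm_pair2.
Qed.

(** The Efron-Stein inequality: with f1 and f2 the conditional means of F and c
    its mean, F - f1 - f2 + c has a nonnegative mean square, and all cross terms
    reduce to those of the statement by Fubini's theorem. *)
Lemma efron_stein F : bounded_measurable F ->
  mean P (fun x => mean Q (fun y => F (x, y)) ^+ 2) +
  mean Q (fun y => mean P (fun x => F (x, y)) ^+ 2) <=
  mean (P \x Q)%E (fun z => F z ^+ 2) + mean (P \x Q)%E F ^+ 2.
Proof.
move=> bF.
have [b1 E1] := fubini_mean1 bF; have [b2 E2] := fubini_mean2 bF.
set f1 := fun x => mean Q _ in b1 E1 *; set f2 := fun y => mean P _ in b2 E2 *.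
set c := mean (P \x Q)%E F in E1 E2 *.
have bf1 : bounded_measurable (fun z : T1 * T2 => f1 z.1).
  exact: (bm_comp measurable_fst b1).
have bf2 : bounded_measurable (fun z : T1 * T2 => f2 z.2).
  exact: (bm_comp measurable_snd b2).
have L1 (G : T1 * T2 -> R) : bounded_measurable G -> G \in Lfun (P \x Q)%E 1.
  exact: bounded_measurable_Lfun1.
have L1P (G : T1 -> R) : bounded_measurable G -> G \in Lfun P 1.
  exact: bounded_measurable_Lfun1.
have L1Q (G : T2 -> R) : bounded_measurable G -> G \in Lfun Q 1.
  exact: bounded_measurable_Lfun1.
have EF1 : mean (P \x Q)%E (fun z => f1 z.1 * F z) = mean P (fun x => f1 x ^+ 2).
  rewrite (fubini_mean1 (bmM bf1 bF)).2; congr mean; apply/funext => x /=.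
  by rewrite meanZ//; apply: L1Q; exact: bm_pair1.
have EF2 : mean (P \x Q)%E (fun z => f2 z.2 * F z) = mean Q (fun x => f2 x ^+ 2).
  rewrite (fubini_mean2 (bmM bf2 bF)).2; congr mean; apply/funext => x /=.
  by rewrite meanZ//; apply: L1P; exact: bm_pair2.
have E11 : mean (P \x Q)%E (fun z => f1 z.1 ^+ 2) = mean P (fun x => f1 x ^+ 2).
  rewrite (fubini_mean1 (bmX 2 bf1)).2; congr mean; apply/funext => x /=.
  by rewrite mean_cst.
have E22 : mean (P \x Q)%E (fun z => f2 z.2 ^+ 2) = mean Q (fun x => f2 x ^+ 2).
  rewrite (fubini_mean2 (bmX 2 bf2)).2; congr mean; apply/funext => x /=.
  by rewrite mean_cst.
have E12 : mean (P \x Q)%E (fun z => f1 z.1 * f2 z.2) = c ^+ 2.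
  rewrite (fubini_mean1 (bmM bf1 bf2)).2 /=.
  under [X in mean P X]eq_fun do rewrite meanZ ?L1Q// -E2 mulrC.
  by rewrite meanZ ?L1P// -E1 expr2.
have M1 : mean (P \x Q)%E (fun z => f1 z.1) = c.
  rewrite (fubini_mean1 bf1).2 E1; congr mean; apply/funext => x /=.
  by rewrite mean_cst.
have M2 : mean (P \x Q)%E (fun z => f2 z.2) = c.
  rewrite (fubini_mean2 bf2).2 E2; congr mean; apply/funext => x /=.
  by rewrite mean_cst.
pose G1 z := F z ^+ 2 + f1 z.1 ^+ 2 + f2 z.2 ^+ 2 + 2 * c * F z + 2 * (f1 z.1 * f2 z.2).
pose G2 z := 2 * (f1 z.1 * F z) + 2 * (f2 z.2 * F z) + 2 * c * f1 z.1 + 2 * c * f2 z.2 - c ^+ 2.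
have : 0 <= mean (P \x Q)%E (fun z => (F z - f1 z.1 - f2 z.2 + c) ^+ 2).
  by apply: mean_ge0 => z; exact: sqr_ge0.
have -> : (fun z => (F z - f1 z.1 - f2 z.2 + c) ^+ 2) = (fun z => G1 z - G2 z).
  by apply/funext => z; rewrite /G1 /G2; ring.
have bc := @bm_cst _ (T1 * T2)%type R.
have q1 := bmX 2 bF; have q2 := bmX 2 bf1; have q3 := bmX 2 bf2.
have q4 := bmZ (2 * c) bF; have q5 := bmZ 2 (bmM bf1 bf2).
have r1 := bmZ 2 (bmM bf1 bF); have r2 := bmZ 2 (bmM bf2 bF).
have r3 := bmZ (2 * c) bf1; have r4 := bmZ (2 * c) bf2.
have q12 := bmD q1 q2; have q123 := bmD q12 q3; have q1234 := bmD q123 q4.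
have r12 := bmD r1 r2; have r123 := bmD r12 r3; have r1234 := bmD r123 r4.
have q := bmD q1234 q5; have r := bmB r1234 (bc (c ^+ 2)).
rewrite meanB; [|exact: L1 q|exact: L1 r].
rewrite /G1 /G2 !(meanD (L1 _ q1234) (L1 _ q5)) (meanD (L1 _ q123) (L1 _ q4)).
rewrite (meanD (L1 _ q12) (L1 _ q3)) (meanD (L1 _ q1) (L1 _ q2)).
rewrite (meanB (L1 _ r1234) (L1 _ (bc _))) (meanD (L1 _ r123) (L1 _ r4)).
rewrite (meanD (L1 _ r12) (L1 _ r3)) (meanD (L1 _ r1) (L1 _ r2)) mean_cst.
rewrite !meanZ; try by apply: L1 => //; exact: bmM.
rewrite EF1 EF2 E11 E22 E12 M1 M2 -/c; lra.
Qed.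

End fubini_mean.

(** * The variance of a smooth function under a convolution *)

Section C11_calculus.
Context {R : realType} {d : nat}.
Implicit Types (x y z h : 'rV[R]_d) (f : 'rV[R]_d -> R).
Implicit Types (g : 'rV[R]_d -> 'rV[R]_d) (nu : probability (borelRn R d) R).

Lemma dotv_delta i v : dotv (delta_mx 0 i : 'rV[R]_d) v = v 0 i.
Proof.
rewrite /dotv (bigD1 i)//= big1 ?addr0 => [|j ji].
  by rewrite mxE !eqxx mul1r.
by rewrite mxE (negPf ji) andbF mul0r.
Qed.

Lemma C11_field_bm f g i : C11 f g ->
  bounded_measurable ((fun x => g x 0 i) : borelRn R d -> R).
Proof.
move=> [_ [l [l0 fl gl fg]]]; split; first exact: elip_measurable (gl i).
exists (2 * l) => x.
have := fg x (delta_mx 0 i); have := fl (x + delta_mx 0 i) x.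
rewrite addrAC subrr add0r enorm_delta expr1n mulr1 dotv_delta !ler_norml.
by move=> /andP[? ?] /andP[? ?]; apply/andP; split; lra.
Qed.

Lemma C11_translate f g x : C11 f g ->
  C11 (fun y => f (x + y)) (fun y => g (x + y)).
Proof.
move=> [[M fM] [l [l0 fl gl fg]]]; split; first by exists M.
exists l; split => // [y z|i y z|y h].
- by apply: le_trans (fl _ _) _; rewrite opprD addrACA subrr add0r.
- by apply: le_trans (gl i _ _) _; rewrite opprD addrACA subrr add0r.
- by rewrite addrA; exact: fg.
Qed.

Lemma mean_dist_le nu (u v : borelRn R d -> R) (c : R) : bounded_measurable u ->
  bounded_measurable v -> (forall x, `|u x - v x| <= c) ->
  `|mean nu u - mean nu v| <= c.
Proof.
move=> bu bv uv; rewrite -meanB; try exact: bounded_measurable_Lfun1.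
by apply: mean_bound => //; exact: bmB.
Qed.

(** The gradient of a conditional mean is the conditional mean of the gradient:
    the Taylor estimate is integrated, no limit is taken. *)
Lemma C11_mean nu f g : C11 f g ->
  C11 (fun x => mean nu (fun y => f (x + y)))
      (fun x => \row_i mean nu (fun y => g (x + y) 0 i)).
Proof.
move=> fgC; have [[M fM] [l [l0 fl gl fg]]] := fgC.
have bf x : bounded_measurable ((fun y => f (x + y)) : borelRn R d -> R).
  exact: C11_bounded_measurable (C11_translate x fgC).
have bg x i : bounded_measurable ((fun y => g (x + y) 0 i) : borelRn R d -> R).
  exact: C11_field_bm i (C11_translate x fgC).
split; first by exists M => x; apply: mean_bound.
exists l; split => // [x y|i x y|x h].
- apply: mean_dist_le => // z; apply: le_trans (fl _ _) _.
  by rewrite opprD addrACA subrr addr0.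
- rewrite !mxE; apply: mean_dist_le => // z; apply: le_trans (gl i _ _) _.
  by rewrite opprD addrACA subrr addr0.
- have L1 (u : borelRn R d -> R) : bounded_measurable u -> u \in Lfun nu 1.
    exact: bounded_measurable_Lfun1.
  have bZ i := bmZ (h 0 i) (bg x i).
  have [_ dE] := mean_sum (index_enum 'I_d) (fun i => L1 _ (bZ i)).
  rewrite (_ : dotv h _ = mean nu (fun y => dotv h (g (x + y)))); last first.
    rewrite [RHS]dE; apply: eq_bigr => i _; rewrite mxE meanZ//; exact: L1.
  rewrite -meanB; [|exact: L1|exact: L1].
  have bd : bounded_measurable ((fun y => dotv h (g (x + y))) : borelRn R d -> R).
    by apply: bm_sum => i; exact: bZ.
  apply: (mean_dist_le _ (bmB (bf (x + h)) (bf x)) bd) => y.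
  by rewrite (addrAC x h); exact: fg.
Qed.

End C11_calculus.

Section convolution_poincare.
Context {R : realType} {d : nat}.
Implicit Types (f : 'rV[R]_d -> R) (g : 'rV[R]_d -> 'rV[R]_d).
Implicit Types (mu nu : probability (borelRn R d) R).

Definition smooth_poincare mu (a : R) := forall f g, C11 f g ->
  mean mu (fun x => f x ^+ 2) - mean mu f ^+ 2 <=
  a * mean mu (fun x => enorm (g x) ^+ 2).

Lemma bm_addRn (u : borelRn R d -> R) : bounded_measurable u ->
  bounded_measurable (u \o @addRn R d).
Proof. by apply: bm_comp; exact: measurable_addRn. Qed.

Lemma C11_enorm2_bm f g : C11 f g ->
  bounded_measurable ((fun x => enorm (g x) ^+ 2) : borelRn R d -> R).
Proof.
move=> fg; under eq_fun do rewrite enorm_sqr.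
by apply: bm_sum => i; apply: bmM; exact: C11_field_bm fg.
Qed.

(** Conditioning on the first variable: the variance of f (X + Y) is the mean of
    the conditional variance plus the variance of the conditional mean. *)
Lemma conditional_poincare mu nu (a b : R) f g : 0 <= a ->
  smooth_poincare mu a -> smooth_poincare nu b -> C11 f g ->
  mean (mu \x nu)%E (fun z => f (addRn z) ^+ 2) -
    mean (mu \x nu)%E (fun z => f (addRn z)) ^+ 2 <=
  b * mean (mu \x nu)%E (fun z => enorm (g (addRn z)) ^+ 2) +
  a * \sum_(i < d) mean mu (fun x => mean nu (fun y => g (x + y) 0 i) ^+ 2).
Proof.
move=> a0 Hmu Hnu fg.
have bf : bounded_measurable (f : borelRn R d -> R) by exact: C11_bounded_measurable fg.
have [b1 E1] := fubini_mean1 mu nu (bm_addRn bf).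
have [b2 E2] := fubini_mean1 mu nu (bm_addRn (bmX 2 bf)).
have [b3 E3] := fubini_mean1 mu nu (bm_addRn (C11_enorm2_bm fg)).
rewrite /comp/= in b1 b2 b3 E1 E2 E3.
rewrite E1 E2 E3 /addRn /=.
have L1 (u : borelRn R d -> R) : bounded_measurable u -> u \in Lfun mu 1.
  exact: bounded_measurable_Lfun1.
have fgm := C11_mean nu fg.
have H1 := Hmu _ _ fgm.
have H2 : mean mu (fun x => mean nu (fun y => f (x + y) ^+ 2)) <=
    mean mu (fun x => mean nu (fun y => f (x + y)) ^+ 2) +
    b * mean mu (fun x => mean nu (fun y => enorm (g (x + y)) ^+ 2)).
  rewrite -(meanZ b); last exact: L1.
  rewrite -meanD; [|exact: L1 (bmX 2 b1)|exact: L1 (bmZ b b3)].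
  apply: mean_le; [exact: L1|exact: L1 (bmD (bmX 2 b1) (bmZ b b3))|].
  by move=> x; have := Hnu _ _ (C11_translate x fg); rewrite lerBlDl.
have H3 : mean mu (fun x => enorm (\row_i mean nu (fun y => g (x + y) 0 i) : 'rV[R]_d) ^+ 2) =
    \sum_(i < d) mean mu (fun x => mean nu (fun y => g (x + y) 0 i) ^+ 2).
  have bgm i := bmX 2 (fubini_mean1 mu nu (bm_addRn (C11_field_bm i fg))).1.
  have [_ <-] := mean_sum (index_enum 'I_d) (fun i => L1 _ (bgm i)).
  congr mean; apply/funext => x; rewrite enorm_sqr; apply: eq_bigr => i _.
  by rewrite mxE expr2.
move: H1; rewrite H3 => H1; lra.
Qed.

Lemma mean_swap (P Q : probability (borelRn R d) R)
    (F : borelRn R d * borelRn R d -> R) : bounded_measurable F ->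
  (forall x y, F (x, y) = F (y, x)) ->
  mean (Q \x P)%E F = mean (P \x Q)%E F.
Proof.
move=> bF FC; rewrite (fubini_mean1 Q P bF).2 (fubini_mean2 P Q bF).2.
congr mean; apply/funext => x; congr mean; apply/funext => y; exact: FC.
Qed.

Lemma mean_convolution mu nu (u : borelRn R d -> R) : bounded_measurable u ->
  mean (convolution mu nu) u = mean (mu \x nu)%E (fun z => u (addRn z)).
Proof.
move=> bu; rewrite /mean unlock integral_distribution//.
  by case: bu => mu' _; exact/measurable_EFinP.
by apply/Lfun1_integrable/bounded_measurable_Lfun1; exact: bm_addRn.
Qed.

(** Average of the two conditional bounds with weights b / (a + b) and a / (a + b).
    With these weights the two sums of conditional terms get the same coefficient
    a * b / (a + b), as the Efron-Stein inequality requires. *)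
Lemma convolution_smooth_poincare mu nu (a b : R) f g : 0 <= a -> 0 <= b ->
  0 < a + b -> smooth_poincare mu a -> smooth_poincare nu b -> C11 f g ->
  mean (convolution mu nu) (fun x => f x ^+ 2) - mean (convolution mu nu) f ^+ 2 <=
  (a + b - a * b / (a + b)) * mean (convolution mu nu) (fun x => enorm (g x) ^+ 2) +
  a * b / (a + b) * \sum_(i < d) mean (convolution mu nu) (fun x => g x 0 i) ^+ 2.
Proof.
move=> a0 b0 ab Hmu Hnu fg.
have bf : bounded_measurable (f : borelRn R d -> R) by exact: C11_bounded_measurable fg.
have bg i : bounded_measurable ((fun x => g x 0 i) : borelRn R d -> R).
  exact: C11_field_bm fg.
have be := C11_enorm2_bm fg.
have A1 := conditional_poincare a0 Hmu Hnu fg.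
have A2 := conditional_poincare b0 Hnu Hmu fg.
have aC x y : @addRn R d (x, y) = addRn (y, x) by rewrite /addRn/= addrC.
have sw (u : borelRn R d -> R) : bounded_measurable u ->
    mean (nu \x mu)%E (fun z => u (addRn z)) = mean (mu \x nu)%E (fun z => u (addRn z)).
  by move=> bu; apply: mean_swap; [exact: bm_addRn|move=> x y; rewrite aC].
rewrite (sw _ bf) (sw _ be) (sw _ (bmX 2 bf)) in A2.
rewrite (mean_convolution _ _ bf) (mean_convolution _ _ be) (mean_convolution _ _ (bmX 2 bf)).
under eq_bigr => i _ do rewrite (mean_convolution _ _ (bg i)).
set V := _ - _ in A1 A2 *; set S := mean _ _ in A1 A2 *.
set A := \sum_(i < d) _ in A1; set B := \sum_(i < d) _ in A2; set T := \sum_(i < d) _.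
have AB : A + B <= S + T.
  have -> : S = \sum_(i < d) mean (mu \x nu)%E (fun z => g (addRn z) 0 i ^+ 2).
    have L i : (fun z => g (addRn z) 0 i ^+ 2) \in Lfun (mu \x nu)%E 1.
      exact: bounded_measurable_Lfun1 (bmX 2 (bm_addRn (bg i))).
    have [_ <-] := mean_sum (index_enum 'I_d) L.
    congr mean; apply/funext => z; rewrite enorm_sqr; apply: eq_bigr => i _.
    by rewrite expr2.
  rewrite -!big_split; apply: ler_sum => i _ /=.
  have := efron_stein mu nu (bm_addRn (bg i)); rewrite /comp/= => /(le_trans _); apply.
  rewrite lerD2l le_eqVlt; apply/orP; left; apply/eqP.
  congr mean; apply/funext => y; congr (_ ^+ 2); congr mean; apply/funext => x.
  by rewrite addrC.
have ab0 : 0 <= a * b by rewrite mulr_ge0.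
have H1 : b * V <= b * (b * S + a * A) by rewrite ler_wpM2l.
have H2 : a * V <= a * (a * S + b * B) by rewrite ler_wpM2l.
have H3 : a * b * (A + B) <= a * b * (S + T) by rewrite ler_wpM2l.
rewrite -(ler_pM2l ab).
rewrite [leRHS](_ : _ = ((a + b) ^+ 2 - a * b) * S + a * b * T); first by lra.
by field; rewrite gt_eqF.
Qed.

End convolution_poincare.

(** * Elementary properties of the Poincare constant *)

Section quadratic.
Context {R : realFieldType}.

Lemma discriminant_le (al be ga : R) : 0 <= al ->
  (forall t, 0 <= al * t ^+ 2 + 2 * be * t + ga) -> be ^+ 2 <= al * ga.
Proof.
rewrite le_eqVlt => /predU1P[<- H|al0 H].
  have [->|be0] := eqVneq be 0; first by rewrite mul0r expr0n.
  have := H (- (ga + 1) / (2 * be)); rewrite mul0r add0r mulrCA mulfV ?mulf_neq0//.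
  rewrite mulr1; lra.
have := mulr_ge0 (ltW al0) (H (- be / al)).
have -> : al * (al * (- be / al) ^+ 2 + 2 * be * (- be / al) + ga) = al * ga - be ^+ 2.
  by field; rewrite gt_eqF.
by rewrite subr_ge0.
Qed.

End quadratic.

Section poincare_constant_theory.
Local Open Scope ereal_scope.
Context {R : realType} {d : nat}.
Hypothesis d0 : (0 < d)%N.
Implicit Types (mu : probability (borelRn R d) R) (f : 'rV[R]_d -> R).

Lemma gradient_norm_taylor_le f x (v : 'rV[R]_d) (l : R) :
  (forall h, `|f (x + h) - f x - dotv h v| <= l * enorm h ^+ 2)%R ->
  gradient_norm f x <= (enorm v)%:E.
Proof.
move=> H; apply: gradient_norm_le => // e e0.
have l1 : (0 < `|l| + 1)%R by rewrite ltr_wpDl.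
exists (e / (`|l| + 1))%R; first by rewrite divr_gt0.
move=> y; rewrite ltr_pdivlMr// => yx.
have := H (y - x)%R; rewrite subrKC => h1.
have h2 := cauchy_schwarz_dotv (y - x)%R v.
have h3 := ler_normD (f y - f x - dotv (y - x) v)%R (dotv (y - x) v).
rewrite subrK in h3.
have h4 : (l * enorm (y - x) ^+ 2 <= e * enorm (y - x))%R.
  rewrite expr2 mulrA ler_wpM2r//.
  have : (l * enorm (y - x) <= `|l| * enorm (y - x))%R by rewrite ler_wpM2r ?ler_norm.
  have := enorm_ge0 (y - x)%R; lra.
lra.
Qed.

Lemma poincare_constant_ge0 mu : 0 <= poincare_constant mu.
Proof. by apply: le_ereal_inf_tmp => _ [C [C0 _] <-]; rewrite lee_fin. Qed.

(** The constant a itself is admissible as soon as the energy is finite. An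
    infinite energy is excluded because, when a = 0, the product of a with it
    would be 0. *)
Lemma poincare_constant_variance mu (a E : R) f : poincare_constant mu = a%:E ->
  locally_lipschitz f -> \int[mu]_x gradient_norm f x ^+ 2 <= E%:E ->
  'V_mu[f] <= (a * E)%:E.
Proof.
move=> ma fl fE.
have I0 : 0 <= \int[mu]_x gradient_norm f x ^+ 2.
  by apply: integral_ge0 => x _; apply: sqre_ge0; exact: gradient_norm_ge0.
have E0 : (0 <= E)%R by rewrite -lee_fin (le_trans I0).
apply/lee_addgt0Pr => e e0.
have e'0 : (0 < e / (E + 1))%R by rewrite divr_gt0// ltr_wpDl.
have [_ [C [C0 HC] <-] Ca] : exists2 y, [set C%:E | C in [set C : R | (0 <= C)%R /\
    poincare_inequality mu C]] y & y < (a + e / (E + 1))%:E.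
  by apply: ereal_inf_lt; rewrite -/(poincare_constant mu) ma lte_fin ltrDl.
apply: le_trans (HC f fl) _; apply: (@le_trans _ _ (C%:E * E%:E)).
  by rewrite lee_wpmul2l.
rewrite -EFinM -EFinD lee_fin; rewrite lte_fin in Ca.
apply: (@le_trans _ _ ((a + e / (E + 1)) * E)%R); first by rewrite ler_wpM2r// ltW.
rewrite mulrDl lerD2l mulrAC ler_pdivrMr ?ltr_wpDl// mulrDr mulr1 lerDl.
exact: ltW.
Qed.

Lemma smooth_gradient_integral mu f (g : 'rV[R]_d -> 'rV[R]_d) (l : R) :
  (forall x h, `|f (x + h) - f x - dotv h (g x)| <= l * enorm h ^+ 2)%R ->
  continuous f -> bounded_measurable ((fun x => enorm (g x) ^+ 2)%R : borelRn R d -> R) ->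
  \int[mu]_x gradient_norm f x ^+ 2 <= (mean mu (fun x => enorm (g x) ^+ 2)%R)%:E.
Proof.
move=> fg fc bg; rewrite -mean_EFin; last exact: bounded_measurable_Lfun1.
have G0 x : 0 <= gradient_norm f x by exact: gradient_norm_ge0.
apply: ge0_le_integral => //.
- by move=> x _; exact: sqre_ge0.
- under eq_fun do rewrite expe2.
  by apply: emeasurable_funM; exact: measurable_gradient_norm.
- by apply/measurable_EFinP; case: bg.
- move=> x _; have := gradient_norm_taylor_le (fg x); rewrite EFin_expe !expe2 => h.
  exact: lee_pmul.
Qed.

Lemma poincare_constant_smooth mu (a : R) : poincare_constant mu = a%:E ->
  smooth_poincare mu a.
Proof.
move=> ma f g fg; have [_ [l [l0 fl gl fgl]]] := fg.
rewrite -lee_fin -variance_mean; last exact: bounded_measurable_Lfun2 (C11_bounded_measurable fg).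
apply: (poincare_constant_variance ma); first exact: elip_locally_lipschitz fl.
exact: smooth_gradient_integral fgl (elip_continuous fl) (C11_enorm2_bm fg).
Qed.

Lemma smooth_poincare_constant mu (K : R) : (0 < K)%R -> smooth_poincare mu K ->
  poincare_constant mu <= K%:E.
Proof.
move=> K0 HK; apply: ereal_inf_lbound; exists K => //; split; first exact: ltW.
apply: poincare_of_smooth => // w g wg.
rewrite variance_mean; last exact: bounded_measurable_Lfun2 (C11_bounded_measurable wg).
rewrite mean_EFin; last exact: bounded_measurable_Lfun1 (C11_enorm2_bm wg).
by rewrite -EFinM lee_fin; exact: HK.
Qed.

Lemma smooth_poincareW mu (a b : R) : (a <= b)%R -> smooth_poincare mu a ->
  smooth_poincare mu b.
Proof.
move=> ab H f g fg; apply: le_trans (H f g fg) _; rewrite ler_wpM2r//.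
by apply: mean_ge0 => x; exact: sqr_ge0.
Qed.

Lemma mean_field_le mu f (g : 'rV[R]_d -> 'rV[R]_d) : C11 f g ->
  (\sum_(i < d) mean mu (fun x => g x 0 i) ^+ 2 <= mean mu (fun x => enorm (g x) ^+ 2))%R.
Proof.
move=> fg; have bg i := C11_field_bm i fg.
have L i : (fun x => g x 0 i ^+ 2)%R \in Lfun mu 1.
  exact: bounded_measurable_Lfun1 (bmX 2 (bg i)).
rewrite (_ : (fun x => _) = (fun x => \sum_(i < d) g x 0 i ^+ 2)%R); last first.
  by apply/funext => x; rewrite enorm_sqr; apply: eq_bigr => i _; rewrite expr2.
have [_ ->] := mean_sum (index_enum 'I_d) L.
apply: ler_sum => i _; rewrite -subr_ge0 -lee_fin -variance_mean ?variance_ge0//.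
exact: bounded_measurable_Lfun2 (bg i).
Qed.

(** The defect term of [convolution_smooth_poincare] is nonnegative. Both constants
    are increased by e / 2 to cover the case where they vanish. *)
Lemma convolution_subadditive mu nu (a b : R) :
  poincare_constant mu = a%:E -> poincare_constant nu = b%:E ->
  poincare_constant (convolution mu nu) <= (a + b)%:E.
Proof.
move=> ma nb.
have a0 : (0 <= a)%R by rewrite -lee_fin -ma poincare_constant_ge0.
have b0 : (0 <= b)%R by rewrite -lee_fin -nb poincare_constant_ge0.
apply/lee_addgt0Pr => e e0.
have e20 : (0 < e / 2)%R by rewrite divr_gt0.
pose a' := (a + e / 2)%R; pose b' := (b + e / 2)%R.
have a'0 : (0 < a')%R by rewrite ltr_wpDl.
have b'0 : (0 < b')%R by rewrite ltr_wpDl.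
rewrite -EFinD (_ : a + b + e = a' + b')%R; last by rewrite /a' /b'; lra.
apply: smooth_poincare_constant; first by rewrite addr_gt0.
move=> f g fg.
have Hmu : smooth_poincare mu a'.
  by apply: smooth_poincareW (poincare_constant_smooth ma); rewrite lerDl ltW.
have Hnu : smooth_poincare nu b'.
  by apply: smooth_poincareW (poincare_constant_smooth nb); rewrite lerDl ltW.
have k0 : (0 <= a' * b' / (a' + b'))%R by rewrite divr_ge0 ?mulr_ge0 ?addr_ge0// ltW.
have := convolution_smooth_poincare (ltW a'0) (ltW b'0) (addr_gt0 a'0 b'0) Hmu Hnu fg.
move/le_trans; apply.
have := ler_wpM2l k0 (mean_field_le (convolution mu nu) fg); lra.
Qed.

Lemma dotv_locally_lipschitz (v : 'rV[R]_d) : elip (enorm v) (dotv v).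
Proof. by move=> x y; rewrite -dotvBr cauchy_schwarz_dotv. Qed.

End poincare_constant_theory.

(** * Near-extremal functions and stability *)

(** Both quadratic polynomials in t are nonnegative. Their discriminants give
    B <= sqrt s * k and c * T - B <= q * k, where k is the square root of c * T * S.
    Hence sqrt (c * T) <= (sqrt s + q) * sqrt S. *)
Lemma near_extremal_gradient_algebra (R : rcfType) (V S T B D c s q : R) :
  0 < c -> 0 <= s <= c -> 0 < q -> 0 <= T -> 0 <= S -> 0 <= V ->
  0 <= D <= s * T -> V <= c * S -> (c - q ^+ 2) * S <= V ->
  (forall t, 0 <= D * t ^+ 2 + 2 * B * t + V) ->
  (forall t, V + 2 * t * B + t ^+ 2 * D <= c * (S + 2 * t * T + t ^+ 2 * T)) ->
  c * T <= (Num.sqrt s + q) ^+ 2 * S.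
Proof.
move=> c0 /andP[s0 sc] q0 T0 S0 V0 /andP[D0 DsT] VcS VS HB HT.
have sT : s * T <= c * T by rewrite ler_wpM2r.
have B2 : B ^+ 2 <= D * V by apply: discriminant_le.
have C2 : (c * T - B) ^+ 2 <= (c * T - D) * (c * S - V).
  apply: discriminant_le => [|t]; first lra.
  have := HT t; lra.
have {}B2 : B ^+ 2 <= s * T * (c * S).
  by apply: le_trans B2 _; exact: ler_pM.
have {}C2 : (c * T - B) ^+ 2 <= c * T * (q ^+ 2 * S).
  apply: le_trans C2 _; apply: ler_pM; lra.
pose k := Num.sqrt (c * T) * Num.sqrt S.
have k0 : 0 <= k by rewrite mulr_ge0 ?sqrtr_ge0.
have cT0 : 0 <= c * T by rewrite mulr_ge0// ltW.
have k2 : k ^+ 2 = c * T * S by rewrite exprMn !sqr_sqrtr.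
have B1 : B <= Num.sqrt s * k.
  apply: le_trans (ler_norm _) _.
  rewrite -ler_sqr ?nnegrE ?mulr_ge0 ?sqrtr_ge0//.
  by rewrite real_normK ?num_real// exprMn sqr_sqrtr// k2; lra.
have C1 : c * T - B <= q * k.
  apply: le_trans (ler_norm _) _.
  rewrite -ler_sqr ?nnegrE ?mulr_ge0 ?(ltW q0)//.
  by rewrite real_normK ?num_real// exprMn k2; lra.
have H : c * T <= (Num.sqrt s + q) * k by lra.
have [T00|cTn0] := eqVneq (c * T) 0; first by rewrite T00 mulr_ge0// sqr_ge0.
have cTp : 0 < c * T by rewrite lt0r cTn0.
have sq0 : 0 <= Num.sqrt s + q by rewrite addr_ge0 ?sqrtr_ge0 ?(ltW q0).
rewrite -(ler_pM2l cTp) -expr2.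
rewrite (_ : c * T * _ = ((Num.sqrt s + q) * k) ^+ 2); last first.
  by rewrite exprMn k2; ring.
by apply: lerXn2r => //; rewrite nnegrE// mulr_ge0.
Qed.

Section near_extremal.
Local Open Scope ereal_scope.
Context {R : realType} {d : nat}.
Hypothesis d0 : (0 < d)%N.
Variables (m : probability (borelRn R d) R) (c s : R).
Hypothesis mc : poincare_constant m = c%:E.
Hypothesis ms : forall v : 'rV[R]_d, 'V_m[dotv v] <= (s * enorm v ^+ 2)%:E.

(** The variance of f + t (v . x) is a quadratic polynomial in t, at most c times
    the energy, which is a quadratic polynomial in t as well because the mean
    gradient of f is v. *)
Lemma perturbation_inequality (f : 'rV[R]_d -> R) g (v : 'rV[R]_d) (t : R) : C11 f g ->
  (forall i, v 0%R i = mean m (fun x => g x 0%R i)) ->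
  let V := (mean m (fun x => f x ^+ 2) - mean m f ^+ 2)%R in
  let B := (mean m (fun x => f x * dotv v x) - mean m f * mean m (dotv v))%R in
  let D := (mean m (fun x => dotv v x ^+ 2) - mean m (dotv v) ^+ 2)%R in
  let S := (mean m (fun x => enorm (g x) ^+ 2))%R in
  let T := (enorm v ^+ 2)%R in
  [/\ 'V_m[dotv v] = D%:E,
    (0 <= D * t ^+ 2 + 2 * B * t + V)%R &
    (V + 2 * t * B + t ^+ 2 * D <= c * (S + 2 * t * T + t ^+ 2 * T))%R].
Proof.
move=> fg vE V B D S T.
have bf := C11_bounded_measurable fg; have bg i := C11_field_bm i fg.
have f2 := bounded_measurable_Lfun2 m bf.
have lv := dotv_locally_lipschitz v.
have v2 : dotv v \in Lfun m 2%:E.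
  apply: variance_lty_Lfun2; first exact: elip_measurable lv.
  by apply: le_lt_trans (ms v) _; rewrite ltry.
have VD : 'V_m[dotv v] = D%:E by rewrite variance_mean.
have f1 := Lfun2_Lfun1 f2; have v1 := Lfun2_Lfun1 v2.
have ff := Lfun2_sqr f2; have vv := Lfun2_sqr v2; have fv := Lfun2_mul f2 v2.
have tv1 := Lfun1Z t v1.
have h2 : (fun x => f x + t * dotv v x)%R \in Lfun m 2%:E.
  exact: (Lfun2D f2 (Lfun2Z t v2)).
have Vh : 'V_m[(fun x => f x + t * dotv v x)%R] = (V + 2 * t * B + t ^+ 2 * D)%:E.
  rewrite variance_mean// (meanD f1 tv1) (meanZ t v1).
  rewrite (_ : (fun x => (f x + t * dotv v x) ^+ 2)%R =
    (fun x => f x ^+ 2 + 2 * t * (f x * dotv v x) + t ^+ 2 * dotv v x ^+ 2)%R); last first.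
    by apply/funext => x; ring.
  rewrite (meanD (Lfun1D ff (Lfun1Z (2 * t) fv)) (Lfun1Z (t ^+ 2) vv)).
  rewrite (meanD ff (Lfun1Z (2 * t) fv)) (meanZ (2 * t) fv) (meanZ (t ^+ 2) vv).
  by congr (_%:E); rewrite /V /B /D; ring.
split => //.
  have := variance_ge0 m (fun x => f x + t * dotv v x)%R.
  by rewrite Vh lee_fin; lra.
have [_ [l [l0 fl gl fgl]]] := fg.
pose gt x := (g x + t *: v)%R.
have bgt : bounded_measurable ((fun x => enorm (gt x) ^+ 2)%R : borelRn R d -> R).
  under eq_fun do rewrite enorm_sqr.
  apply: bm_sum => i; apply: bmM; under eq_fun do rewrite mxE;
    by apply: bmD => //; exact: bm_cst.
have St : mean m (fun x => enorm (gt x) ^+ 2)%R = (S + 2 * t * T + t ^+ 2 * T)%R.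
  have L i : (fun x => v 0 i * g x 0 i)%R \in Lfun m 1.
    exact: bounded_measurable_Lfun1 (bmZ (v 0%R i) (bg i)).
  have [Ld dE] := mean_sum (index_enum 'I_d) L.
  have {}dE : mean m (fun x => dotv v (g x)) = T.
    rewrite [LHS]dE /T enorm_sqr; apply: eq_bigr => i _.
    by rewrite (meanZ _ (bounded_measurable_Lfun1 m (bg i))) vE.
  have LS := bounded_measurable_Lfun1 m (C11_enorm2_bm fg).
  have Ld' := Lfun1Z (2 * t) Ld.
  rewrite (_ : (fun x => _) = (fun x => enorm (g x) ^+ 2 +
      2 * t * dotv v (g x) + t ^+ 2 * T)%R); last first.
    apply/funext => x; rewrite /gt /T !enorm_sqr dotvDl !dotvDr !dotvZl !dotvZr.
    by rewrite (dotvC (g x) v); ring.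
  rewrite (meanD (Lfun1D LS Ld') (Lfun1_cst m _)) (meanD LS Ld') (meanZ _ Ld).
  by rewrite mean_cst dE.
rewrite -lee_fin -Vh -St.
have hl : elip (l + `|t| * enorm v) (fun x => f x + t * dotv v x)%R.
  move=> x y.
  rewrite opprD addrACA -mulrBr mulrDl (le_trans (ler_normD _ _))// lerD//.
  by rewrite normrM -mulrA ler_wpM2l.
apply: (poincare_constant_variance d0 mc); first exact: elip_locally_lipschitz hl.
apply: (@smooth_gradient_integral _ _ d0 m _ gt l) => //.
  move=> x h; rewrite /gt [dotv h _]dotvDr dotvZr dotvDr (dotvC v h).
  rewrite (_ : _ - _ = f (x + h) - f x - dotv h (g x))%R; first exact: fgl.
  by ring.
exact: elip_continuous hl.
Qed.

Lemma near_extremal_gradient (q : R) f g : (0 < c)%R -> (0 <= s <= c)%R ->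
  (0 < q)%R -> C11 f g ->
  let S := (mean m (fun x => enorm (g x) ^+ 2))%R in
  ((c - q ^+ 2) * S <= mean m (fun x => f x ^+ 2) - mean m f ^+ 2)%R ->
  (c * \sum_(i < d) mean m (fun x => g x 0 i) ^+ 2 <= (Num.sqrt s + q) ^+ 2 * S)%R.
Proof.
move=> c0 sc q0 fg S HS.
pose v : 'rV[R]_d := (\row_i mean m (fun x => g x 0 i))%R.
have vE i : (v 0 i = mean m (fun x => g x 0 i))%R by rewrite mxE.
have -> : (\sum_(i < d) mean m (fun x => g x 0 i) ^+ 2 = enorm v ^+ 2)%R.
  by rewrite enorm_sqr; apply: eq_bigr => i _; rewrite vE expr2.
have P t := @perturbation_inequality f g v t fg vE.
have [VD _ _] := P 0%R.
pose B := (mean m (fun x => f x * dotv v x) - mean m f * mean m (dotv v))%R.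
pose D := (mean m (fun x => dotv v x ^+ 2) - mean m (dotv v) ^+ 2)%R.
apply: (@near_extremal_gradient_algebra R _ S (enorm v ^+ 2) B D c s q _ _ _ _ _ _ _ _ HS) => //.
- exact: sqr_ge0.
- by apply: mean_ge0 => x; exact: sqr_ge0.
- have := variance_ge0 m f; rewrite variance_mean ?lee_fin//.
  exact: bounded_measurable_Lfun2 (C11_bounded_measurable fg).
- by rewrite -!lee_fin /D -VD variance_ge0 ms.
- exact: poincare_constant_smooth mc _ _ fg.
- by move=> t; have [_ h _] := P t; exact: h.
- by move=> t; have [_ _ h] := P t; exact: h.
Qed.

End near_extremal.

Section stability.
Local Open Scope ereal_scope.
Context {R : realType} {d : nat}.
Hypothesis d0 : (0 < d)%N.
Variables (mu nu : probability (borelRn R d) R) (a b c s : R).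
Hypothesis mua : poincare_constant mu = a%:E.
Hypothesis nub : poincare_constant nu = b%:E.
Hypothesis mc : poincare_constant (convolution mu nu) = c%:E.
Hypothesis ms : forall v : 'rV[R]_d,
  'V_(convolution mu nu)[dotv v] <= (s * enorm v ^+ 2)%:E.

(** Otherwise some K = c - q^2 lies between the bound and c. As K is not admissible,
    some smooth f violates the inequality with constant K; its mean gradient is
    small by [near_extremal_gradient], and [convolution_smooth_poincare]
    contradicts the violation for q small. *)
Lemma convolution_stability : (0 < c)%R -> (0 <= s <= c)%R ->
  (c <= a + b - a * b / (a + b) * (1 - s / c))%R.
Proof.
move=> c0 sc; have /andP[s0 _] := sc.
have a0 : (0 <= a)%R by rewrite -lee_fin -mua poincare_constant_ge0.
have b0 : (0 <= b)%R by rewrite -lee_fin -nub poincare_constant_ge0.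
have cab : (c <= a + b)%R.
  by rewrite -lee_fin -mc; exact: convolution_subadditive.
have ab : (0 < a + b)%R by exact: lt_le_trans cab.
set k := (a * b / (a + b))%R.
have k0 : (0 <= k)%R by rewrite divr_ge0 ?mulr_ge0// ltW.
have kc0 : (0 <= k / c)%R by rewrite divr_ge0// ltW.
rewrite leNgt; apply/negP => H.
pose p := Num.sqrt s.
have p0 : (0 <= p)%R by exact: sqrtr_ge0.
have p2 : (p ^+ 2 = s)%R by rewrite sqr_sqrtr.
pose M := (1 + k / c * (1 + 2 * p))%R.
have M0 : (0 < M)%R by rewrite ltr_pwDl// mulr_ge0// addr_ge0// mulr_ge0.
pose e := (c - (a + b - k * (1 - s / c)))%R.
have e0 : (0 < e)%R by rewrite subr_gt0.
(* Small enough for the error terms below, of total size q * M, not to fill the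
   gap e, and for c - q^2 to be positive. *)
pose q := Num.min 1%R (Num.min (c / 2) (e / 2 / M))%R.
have q0 : (0 < q)%R by rewrite !lt_min ltr01 !divr_gt0.
have q1 : (q <= 1)%R by rewrite ge_min lexx.
have qc : (q <= c / 2)%R by rewrite !ge_min lexx !orbT.
have qe : (q * M <= e / 2)%R by rewrite -ler_pdivlMr// !ge_min lexx !orbT.
have qq : (q ^+ 2 <= q)%R by rewrite expr2 ler_piMr// ltW.
have K0 : (0 < c - q ^+ 2)%R by lra.
have [f [g [fg HS]]] : exists f g, C11 f g /\
    ((c - q ^+ 2) * mean (convolution mu nu) (fun x => enorm (g x) ^+ 2) <
    mean (convolution mu nu) (fun x => f x ^+ 2) - mean (convolution mu nu) f ^+ 2)%R.
  apply: contrapT => NH.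
  have : poincare_constant (convolution mu nu) <= (c - q ^+ 2)%:E.
    apply: smooth_poincare_constant => // f g fg; rewrite leNgt; apply/negP => HS.
    by apply: NH; exists f, g.
  by rewrite mc lee_fin; have := exprn_gt0 2 q0; lra.
have N := near_extremal_gradient d0 mc ms c0 sc q0 fg (ltW HS).
have A := convolution_smooth_poincare a0 b0 ab (poincare_constant_smooth d0 mua)
  (poincare_constant_smooth d0 nub) fg.
rewrite -/k in A; set S := mean _ (fun x => enorm _ ^+ 2)%R in HS N A.
set T := (\sum_(i < d) _)%R in N A.
have S0 : (0 <= S)%R by apply: mean_ge0 => x; exact: sqr_ge0.
have T1 : (k * T <= k / c * ((p + q) ^+ 2 * S))%R.
  rewrite -mulrA; apply: ler_wpM2l => //.
  by rewrite mulrC ler_pdivlMr// mulrC.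
have E1 : ((c - q ^+ 2) * S < (a + b - k + k / c * (p + q) ^+ 2) * S)%R.
  apply: lt_le_trans HS _; apply: le_trans A _; move: T1.
  by clearbody S T k; clear; lra.
have Sp : (0 < S)%R.
  rewrite lt0r S0 andbT; apply: contraTneq E1 => ->.
  by rewrite !mulr0 ltxx.
move: E1; rewrite ltr_pM2r// => E1.
have E2 : (k / c * (p + q) ^+ 2 = k * (s / c) + k / c * (2 * p * q + q ^+ 2))%R.
  by rewrite -p2; ring.
have E3 : (k / c * (2 * p * q + q ^+ 2) <= k / c * (q * (1 + 2 * p)))%R.
  by apply: ler_wpM2l => //; lra.
have E4 : (q * M = q + k / c * (q * (1 + 2 * p)))%R by rewrite /M; ring.
move: E1 E2 E3 E4 qe qq e0; rewrite /e; lra.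
Qed.

End stability.

Section directional_variance.
Local Open Scope ereal_scope.
Context {R : realType} {d : nat}.
Hypothesis d0 : (0 < d)%N.
Variable m : probability (borelRn R d) R.

Lemma linear_gradient_integral (v : 'rV[R]_d) :
  \int[m]_x gradient_norm (dotv v) x ^+ 2 <= (enorm v ^+ 2)%:E.
Proof.
rewrite -[X in _ <= X%:E](mean_cst m).
apply: (@smooth_gradient_integral _ _ d0 m _ (fun=> v) 0%R) => //.
- move=> x h; rewrite dotvDr (dotvC h) (_ : _ - _ = 0)%R ?normr0 ?mul0r//; ring.
- exact: elip_continuous (dotv_locally_lipschitz v).
- exact: bm_cst.
Qed.

Lemma max_variance_le (c : R) : poincare_constant m = c%:E ->
  max_variance m <= c%:E.
Proof.
move=> mc; apply: ge_ereal_sup => _ [v v1 <-]; rewrite -[c]mulr1.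
apply: (poincare_constant_variance d0 mc).
  exact: elip_locally_lipschitz (dotv_locally_lipschitz v).
by apply: le_trans (linear_gradient_integral v) _; rewrite v1 expr1n.
Qed.

Lemma max_variance_ge0 : 0 <= max_variance m.
Proof.
pose u : 'rV[R]_d := delta_mx 0%R (Ordinal d0).
apply: (le_trans (variance_ge0 m (dotv u))).
by apply: ereal_sup_ubound; exists u => //; exact: enorm_delta.
Qed.

Lemma variance_dotv_le (s : R) : max_variance m = s%:E ->
  forall v : 'rV[R]_d, 'V_m[dotv v] <= (s * enorm v ^+ 2)%:E.
Proof.
move=> msE v.
have [v0|v0] := eqVneq (enorm v) 0%R.
  rewrite v0 expr0n mulr0 (_ : dotv v = cst 0%R) ?variance_cst//.
  apply/funext => x; apply/eqP; rewrite -normr_le0.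
  by rewrite (le_trans (cauchy_schwarz_dotv _ _))// v0 mul0r.
pose u := ((enorm v)^-1 *: v)%R.
have u1 : enorm u = 1%R.
  by rewrite enormZ ger0_norm ?invr_ge0// mulVf.
have us : 'V_m[dotv u] <= s%:E by rewrite -msE; apply: ereal_sup_ubound; exists u.
have u2 : dotv u \in Lfun m 2%:E.
  apply: variance_lty_Lfun2; first exact: elip_measurable (dotv_locally_lipschitz u).
  by apply: le_lt_trans us _; rewrite ltry.
rewrite (_ : dotv v = enorm v \o* dotv u)%R; last first.
  by apply/funext => x /=; rewrite /u dotvZl mulrAC mulVf// mul1r.
rewrite varianceZ// (mulrC s) (EFinM _ s); apply: lee_wpmul2l => //; by rewrite lee_fin sqr_ge0.
Qed.

End directional_variance.

Local Open Scope ereal_scope.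
Theorem theorem3 (R : realType) (d : nat) (hd : (0 < d)%N)
    (mu nu : probability (borelRn R d) R) :
  let Cmu := poincare_constant mu in
  let Cnu := poincare_constant nu in
  let C := poincare_constant (convolution mu nu) in
  let sigma2 := max_variance (convolution mu nu) in
  C <= (Cmu + Cnu)
       - Cmu * Cnu / (Cmu + Cnu)
         * ((C - sigma2) ^+ 2 / ((C - sigma2) ^+ 2 + C * sigma2)).
Proof.
cbv zeta.
have a0 := poincare_constant_ge0 mu; have b0 := poincare_constant_ge0 nu.
have [/poincare_bound_y -> //|] := eqVneq (poincare_constant mu + poincare_constant nu) +oo.
  by rewrite leey.
case Ea : (poincare_constant mu) a0 => [a| |] // a0; last first.
  by rewrite addye// -ltNye (lt_le_trans _ b0).
case Eb : (poincare_constant nu) b0 => [b| |] // b0 _.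
have cab := convolution_subadditive hd Ea Eb.
have c0 := poincare_constant_ge0 (convolution mu nu).
case Ec : (poincare_constant (convolution mu nu)) cab c0 => [c| |] // cab c0.
have sc := max_variance_le hd Ec.
have s0 := max_variance_ge0 hd (convolution mu nu).
case Es : (max_variance (convolution mu nu)) sc s0 => [s| |] // sc s0.
rewrite !lee_fin in a0 b0 cab c0 sc s0.
(* If c = 0, then s = 0 and the last factor is 0 / 0 = 0. *)
have [c00|cn0] := eqVneq c 0%R.
  have s00 : s = 0%R by apply/eqP; rewrite eq_le s0 -c00 sc.
  rewrite c00 s00 subee// expe2 !mul0e mule0 sube0 -EFinD lee_fin addr_ge0//.
have cp : (0 < c)%R by rewrite lt0r cn0.
have ab : (0 < a + b)%R by exact: lt_le_trans cab.
have den0 : (0 < (c - s) ^+ 2 + c * s)%R.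
  rewrite (_ : _ + _ = (c - s) * c + s ^+ 2)%R; last by ring.
  have [->|sn0] := eqVneq s 0%R.
    by rewrite subr0 expr0n addr0 mulr_gt0.
  rewrite ltr_wpDl//; first by rewrite mulr_ge0// subr_ge0.
  by rewrite exprn_even_gt0.
rewrite -EFinB -EFin_expe -!EFinM -!EFinD !inver !gt_eqF// -!EFinM -EFinB lee_fin.
have sc' : (0 <= s <= c)%R by rewrite s0.
have := convolution_stability hd Ea Eb Ec (variance_dotv_le Es) cp sc'.
move=> /le_trans; apply.
rewrite lerD2l lerN2 ler_wpM2l//; first by rewrite divr_ge0 ?mulr_ge0// ltW.
rewrite ler_pdivrMr// -(ler_pM2l cp).
rewrite (_ : (c * ((1 - s / c) * _) = (c - s) * ((c - s) ^+ 2 + c * s))%R); last first.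
  by field; rewrite gt_eqF.
rewrite -subr_ge0.
rewrite (_ : _ - _ = (c - s) * s ^+ 2)%R; last by ring.
by rewrite mulr_ge0 ?sqr_ge0// subr_ge0.
Qed.
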